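(* Let $\Psi$, $m$, $\Psi^m$, $\rho_g^m<\rho_\ell^m$, $p$, $\ell_m$ and $W$ be as in the context. Let $\rho_*\in(\rho_g^m,\rho_\ell^m)$, and assume that $W$ has only one critical point $w_*$ in $(-1,1)$ and that $W''(w_* )<0$. For $0<\varepsilon'<\varepsilon_0$ (with $\varepsilon_0>0$ a suitable constant), let $\rho^1_{\varepsilon'}$ be a non-constant $1$-periodic solution of $$\partial_x\!\left(\frac{m^2}{\rho}\right)+\partial_x\big(p(\rho)\big)=\rho\,\partial_x\big(\varepsilon'\,\partial_x^2\rho\big)\quad\text{in }\mathbb{R}$$ with $\int_0^1\rho^1_{\varepsilon'}\,dx=\rho_*$ and values in $[\rho_g^m,\rho_\ell^m]$, chosen such that $\rho^1_{\varepsilon'}$ converges in $L^1(\mathbb{R}/\mathbb{Z})$, as $\varepsilon'\downarrow0$, to a function with values in $\{\rho_g^m,\rho_\ell^m\}$ having exactly two jumps on $\mathbb{R}/\mathbb{Z}$. Fix a constant $\varepsilon>0$, and for $\omega>0$ with $\varepsilon/\omega^2<\varepsilon_0$ and $\delta_\omega\in\mathbb{R}$ set $$\rho^\omega_\varepsilon(x)=\rho^1_{\varepsilon/\omega^2}\!\left(\frac{x+\delta_\omega}{\omega}\right),\qquad x\in\mathbb{R}.$$ Then, with a suitable choice of $\delta_\omega\in\mathbb{R}$, $\rho^\omega_\varepsilon$ converges, locally uniformly on $\mathbb{R}$, to $\rho^\infty_\varepsilon$ as $\omega\to\infty$, where $\rho^\infty_\varepsilon$ is the (unique up to translation) solution of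 $$\partial_x\!\left(\frac{m^2}{\rho}\right)+\partial_x\big(p(\rho)\big)=\rho\,\partial_x\big(\varepsilon\,\partial_x^2\rho\big)\ \text{ in }\mathbb{R},\qquad \lim_{x\to-\infty}\rho(x)=\rho_g^m,\quad \lim_{x\to+\infty}\rho(x)=\rho_\ell^m,$$ i.e. the density profile of the monotone traveling wave solution of the Euler-Korteweg equations.
   Context: The equations are the stationary one-dimensional isothermal Euler-Korteweg equations (no viscosity) with constant momentum $m$ and density $\rho>0$. Standing assumptions. The volume specific available energy $\Psi=\Psi(\rho)$ is $C^2$ for $\rho>0$, and the pressure is $p(\rho)=\rho\Psi'(\rho)-\Psi(\rho)$. There are two points $\rho_\ell>\rho_g>0$ such that the graph of $\Psi$ has a bitangent line through $(\rho_g,\Psi(\rho_g))$ and $(\rho_\ell,\Psi(\rho_\ell))$ (a line tangent to the graph at both points), and in some neighborhood of $[\rho_g,\rho_\ell]$ the graph of $\Psi$ lies strictly above this line except at $\rho_g$ and $\rho_\ell$. For a constant $m\in\mathbb{R}$ set $\Psi^m(\rho)=\Psi(\rho)-\frac{m^2}{2\rho}$. The constant $m$ is assumed to be such that $\Psi^m$ has the same property with $\rho_g,\rho_\ell$ replaced by some $0<\rho_g^m<\rho_\ell^m$, i.e. the graph of $\Psi^m$ has a bitangent line at $\rho_g^m$ and $\rho_\ell^m$ and lies strictly above it in a neighborhood of $[\rho_g^m,\rho_\ell^m]$ except at these two points; this holds when $|m|$ is sufficiently small. Let $\ell_m(\rho)=(\partial_\rho\Psi^m)(\rho_g^m)(\rho-\rho_g^m)+\Psi^m(\rho_g^m)$,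 the affine function whose graph is the bitangent line of $\Psi^m$, and define $W$ on (a neighborhood of) $[-1,1]$ by $W(w)=\Psi^m(\rho)-\ell_m(\rho)$ with the change of variable $w=\frac{2}{\rho_\ell^m-\rho_g^m}(\rho-\rho_g^m)-1$ (so $\rho=\rho_g^m,\rho_\ell^m$ correspond to $w=-1,1$). Under the standing assumptions it is known that, for a sufficiently small $\varepsilon_0>0$, $1$-periodic solutions $\rho^1_{\varepsilon'}$ with the stated properties exist for $0<\varepsilon'<\varepsilon_0$, and that $\rho^\infty_\varepsilon$ exists, is unique up to translation, and is non-decreasing. *)

(* Defs.v *)
From Stdlib Require Import Reals.
From Coquelicot Require Import Coquelicot.
Open Scope R_scope.

(** [Derive] is total, so differentiability of every lower order is required
    separately. *)
Definition C2_pos (f : R -> R) : Prop :=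
  forall r, 0 < r ->
    ex_derive f r /\ ex_derive_n f 2 r /\ continuous (Derive_n f 2) r.

Definition pressure (Psi : R -> R) (r : R) : R := r * Derive Psi r - Psi r.

Definition Psi_m (Psi : R -> R) (m r : R) : R := Psi r - m ^ 2 / (2 * r).

Definition tangent_line (f : R -> R) (a r : R) : R :=
  Derive f a * (r - a) + f a.

Definition bitangent (f : R -> R) (g l : R) : Prop :=
  0 < g < l /\
  (forall r, tangent_line f g r = tangent_line f l r) /\
  exists eta, 0 < eta /\
    forall r, g - eta < r < l + eta -> r <> g -> r <> l ->
      tangent_line f g r < f r.

(** The inner function is the inverse of [r |-> 2 / (l - g) * (r - g) - 1]. *)
Definition W (f : R -> R) (g l w : R) : R :=
  let r := g + (w + 1) * (l - g) / 2 in f r - tangent_line f g r.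

(** Classical solutions on the whole line, with capillarity coefficient [eps].
    Continuity of the third derivative follows from the equation. *)
Definition korteweg_solution (Psi : R -> R) (m eps : R) (rho : R -> R) : Prop :=
  (forall x, 0 < rho x) /\
  (forall k x, (k <= 3)%nat -> ex_derive_n rho k x) /\
  forall x,
    Derive (fun y => m ^ 2 / rho y) x
      + Derive (fun y => pressure Psi (rho y)) x
    = rho x * Derive (fun y => eps * Derive_n rho 2 y) x.

(** Functions on [R/Z] are represented by 1-periodic functions on [R]. *)
Definition periodic1 (f : R -> R) : Prop := forall x, f (x + 1) = f x.

Definition jump_at (v : R -> R) (x : R) : Prop :=
  exists vl vr : R, vl <> vr /\
    filterlim v (at_left x) (locally vl) /\
    filterlim v (at_right x) (locally vr).

Definition exactly_two_jumps (v : R -> R) : Prop :=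
  exists a b, 0 <= a /\ a < b /\ b < 1 /\
    jump_at v a /\ jump_at v b /\
    forall x, 0 <= x < 1 -> x <> a -> x <> b -> continuous v x.

Definition two_phase_limit (g l : R) (rho : R -> R -> R) : Prop :=
  exists v : R -> R,
    periodic1 v /\
    (forall x, v x = g \/ v x = l) /\
    exactly_two_jumps v /\
    filterlim (fun e => RInt (fun x => Rabs (rho e x - v x)) 0 1)
      (at_right 0) (locally 0).

Definition traveling_wave (Psi : R -> R) (m eps g l : R) (rho : R -> R) : Prop :=
  korteweg_solution Psi m eps rho /\
  is_lim rho m_infty g /\ is_lim rho p_infty l.

Definition cvg_loc_unif (f : R -> R -> R) (h : R -> R) : Prop :=
  forall A e : R, 0 < e ->
    Rbar_locally p_infty
      (fun omega => forall x, Rabs x <= A -> Rabs (f omega x - h x) < e).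

(* Main.v *)
Require Import Defs.
From Stdlib Require Import Reals ZArith Lra Lia.
From Stdlib Require Import Classical IndefiniteDescription FunctionalExtensionality.
From Coquelicot Require Import Coquelicot.
Open Scope R_scope.

(** Let [F = Psi_m - l_m] be the height of [Psi_m] above its bitangent line: a
    [C^2] function vanishing to first order at [g = rho_gm] and [l = rho_lm] and
    positive in between.  After division by [rho], the Euler-Korteweg equation
    with capillarity coefficient [e] integrates twice to
    [e * rho'' = F' (rho) + c] and [e / 2 * rho' ^ 2 = F (rho) + c * rho + d]
    ([korteweg_first_integrals]).

    The traveling wave has [c = d = 0], and it is the inverse function of
    [T r], the integral of [/ sqrt (2 / e * F)] from the midpoint [(g + l) / 2]
    to [r].  Since [F] is at most quadratic at the wells, [T] maps [(g, l)] onto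
    the line ([travel_time], [heteroclinic_exists]).  For any traveling wave,
    its limits force [c = d = 0], and a Gronwall argument with matching data at
    the midpoint gives uniqueness up to translation
    ([traveling_wave_is_translate]).

    For the periodic solution [rho1 e], convergence in mean to a function that
    takes both values [g] and [l] on intervals sends its minimum to [g] and its
    maximum to [l].  At both extrema the slope vanishes, so
    [F (rho) + c * rho + d = 0] there; as [F] tends to zero at these two points
    while their distance tends to [l - g], the constants [c] and [d] of [rho1 e]
    tend to zero ([periodic_profiles_near_well]).  The rescaling by [omega]
    turns the coefficient [eps / omega ^ 2] into [eps] and keeps [c] and [d].
    With [delta] placing an upward crossing of the midpoint at the origin, the
    rescaled solution and the traveling wave have the same value at the origin,
    slopes that differ by a quantity of the order of [c] and [d], and equations
    that differ by [c / eps].  Gronwall's inequality ([profile_close]) then gives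
    uniform convergence on compact intervals. *)

(** * Calculus on the line *)

Lemma mvt_is_derive (f df : R -> R) (a b : R) :
  (forall x, Rmin a b <= x <= Rmax a b -> is_derive f x (df x)) ->
  exists c, Rmin a b <= c <= Rmax a b /\ f b - f a = df c * (b - a).
Proof.
  intros H. apply MVT_gen.
  - intros x Hx. apply H. lra.
  - intros x Hx. apply continuity_pt_filterlim.
    apply (ex_derive_continuous f). exists (df x). now apply H.
Qed.

Lemma nondecreasing_is_derive (f df : R -> R) (a b : R) :
  a <= b ->
  (forall x, a <= x <= b -> is_derive f x (df x)) ->
  (forall x, a <= x <= b -> 0 <= df x) ->
  f a <= f b.
Proof.
  intros Hab Hd Hp.
  destruct (mvt_is_derive f df a b) as [c [Hc E]];
    rewrite ?Rmin_left, ?Rmax_right in * by lra; auto.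
  specialize (Hp c Hc). nra.
Qed.

Lemma constant_of_zero_derive (f : R -> R) :
  (forall x, is_derive f x 0) -> forall x, f x = f 0.
Proof.
  intros H x. destruct (mvt_is_derive f (fun _ => 0) 0 x) as [c [_ E]]; auto. lra.
Qed.

Lemma continuous_epsilon_delta (f : R -> R) (x e : R) :
  continuous f x -> 0 < e ->
  exists d, 0 < d /\ forall z, Rabs (z - x) < d -> Rabs (f z - f x) < e.
Proof.
  intros C He.
  destruct (proj1 (filterlim_locally _ _) C (mkposreal e He)) as [d Hd].
  exists d. split; [apply cond_pos|]. intros z Hz. exact (Hd z Hz).
Qed.

Lemma lipschitz_of_C1 (f df : R -> R) (p q : R) :
  p <= q ->
  (forall x, p <= x <= q -> is_derive f x (df x)) ->
  (forall x, p <= x <= q -> continuous df x) ->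
  exists L, 0 < L /\
    forall x y, p <= x <= q -> p <= y <= q ->
      Rabs (f x - f y) <= L * Rabs (x - y).
Proof.
  intros Hpq Hd Hc.
  destruct (continuity_ab_maj (fun x => Rabs (df x)) p q Hpq) as [M [HM _]].
  { intros c Hcc. apply continuity_pt_filterlim.
    apply (continuous_comp df Rabs); [now apply Hc | apply continuous_Rabs]. }
  exists (Rabs (df M) + 1). pose proof (Rabs_pos (df M)).
  split; [lra|]. intros x y Hx Hy.
  destruct (mvt_is_derive f df y x) as [c [Hcc E]].
  { intros z Hz. apply Hd. revert Hz. unfold Rmin, Rmax.
    destruct (Rle_dec y x); lra. }
  rewrite E, Rabs_mult. apply Rmult_le_compat_r; [apply Rabs_pos|].
  enough (Rabs (df c) <= Rabs (df M)) by lra. apply HM.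
  revert Hcc. unfold Rmin, Rmax. destruct (Rle_dec y x); lra.
Qed.

(** * Gronwall estimates and second-order equations *)

Lemma gronwall_forward (E dE : R -> R) (K eta A x : R) :
  0 <= K -> 0 <= eta -> (forall y, 0 <= E y) ->
  (forall y, Rabs y <= A -> is_derive E y (dE y)) ->
  (forall y, Rabs y <= A -> Rabs (dE y) <= K * (E y + eta)) ->
  0 <= x <= A ->
  E x <= (E 0 + eta) * exp (K * A).
Proof.
  intros HK Heta HE Hd Hb Hx.
  assert (H : - ((E 0 + eta) * exp (- K * 0)) <= - ((E x + eta) * exp (- K * x))).
  { apply (nondecreasing_is_derive (fun y => - ((E y + eta) * exp (- K * y)))
      (fun y => - (dE y * exp (- K * y) + (E y + eta) * (- K * exp (- K * y))))).
    - lra.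
    - intros y Hy. specialize (Hd y ltac:(rewrite Rabs_pos_eq; lra)).
      auto_derive. { exists (dE y); exact Hd. }
      rewrite (is_derive_unique (fun x : R => E x) y _ Hd). ring.
    - intros y Hy. specialize (Hb y ltac:(rewrite Rabs_pos_eq; lra)).
      pose proof (exp_pos (- K * y)). pose proof (Rle_abs (dE y)).
      nra. }
  rewrite Rmult_0_r, exp_0 in H.
  assert (Hle : exp (K * x) <= exp (K * A)).
  { destruct (Rle_lt_or_eq_dec (K * x) (K * A)) as [h|h]; [nra| |].
    - apply Rlt_le, exp_increasing, h.
    - rewrite h; lra. }
  assert (E1 : exp (- K * x) * exp (K * x) = 1).
  { rewrite <- exp_plus. replace (- K * x + K * x) with 0 by ring. apply exp_0. }
  pose proof (exp_pos (K * x)). specialize (HE 0) as HE0.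
  assert (E x + eta <= (E 0 + eta) * exp (K * x)).
  { replace (E x + eta) with ((E x + eta) * exp (- K * x) * exp (K * x))
      by (rewrite Rmult_assoc, E1; ring).
    apply Rmult_le_compat_r; lra. }
  nra.
Qed.

Lemma gronwall (E dE : R -> R) (K eta A x : R) :
  0 <= K -> 0 <= eta -> (forall y, 0 <= E y) ->
  (forall y, Rabs y <= A -> is_derive E y (dE y)) ->
  (forall y, Rabs y <= A -> Rabs (dE y) <= K * (E y + eta)) ->
  Rabs x <= A ->
  E x <= (E 0 + eta) * exp (K * A).
Proof.
  intros HK Heta HE Hd Hb Hx.
  destruct (Rle_dec 0 x) as [h|h].
  - apply gronwall_forward with dE; auto. rewrite Rabs_pos_eq in Hx; lra.
  - assert (H : (fun y => E (- y)) (- x) <= ((fun y => E (- y)) 0 + eta) * exp (K * A)).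
    2: { cbv beta in H. now rewrite Ropp_involutive, Ropp_0 in H. }
    apply (gronwall_forward (fun y => E (- y)) (fun y => - dE (- y)) K eta A (- x)); auto.
    + intros y Hy. assert (Hd' : is_derive E (- y) (dE (- y)))
        by (apply Hd; rewrite Rabs_Ropp; exact Hy).
      auto_derive. { exists (dE (- y)); exact Hd'. }
      rewrite (is_derive_unique (fun x : R => E x) _ _ Hd'). ring.
    + intros y Hy. rewrite Rabs_Ropp. apply Hb. rewrite Rabs_Ropp; exact Hy.
    + rewrite Rabs_left in Hx; lra.
Qed.

(** Two trajectories whose accelerations differ by at most a multiple of their
    distance plus a constant [eta] stay close.  Used with [eta = 0] it gives
    uniqueness for the profile equation, and with small [eta] continuous
    dependence on the first integration constant. *)
Lemma second_order_stability (u u1 u2 w w1 w2 : R -> R) (L eta A x : R) :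
  0 <= L -> 0 <= eta ->
  (forall y, is_derive u y (u1 y)) -> (forall y, is_derive u1 y (u2 y)) ->
  (forall y, is_derive w y (w1 y)) -> (forall y, is_derive w1 y (w2 y)) ->
  (forall y, Rabs y <= A ->
     Rabs (u2 y - w2 y) <= L * Rabs (u y - w y) + eta) ->
  Rabs x <= A ->
  (u x - w x) ^ 2 <=
    ((u 0 - w 0) ^ 2 + (u1 0 - w1 0) ^ 2 + eta ^ 2) * exp ((2 + L) * A).
Proof.
  intros HL Heta Hu Hu1 Hw Hw1 Hb Hx.
  set (E := fun y => (u y - w y) ^ 2 + (u1 y - w1 y) ^ 2).
  assert (HE : E x <= (E 0 + eta ^ 2) * exp ((2 + L) * A)).
  { apply gronwall with (fun y => 2 * (u y - w y) * (u1 y - w1 y)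
                           + 2 * (u1 y - w1 y) * (u2 y - w2 y)); auto.
    - lra.
    - apply pow2_ge_0.
    - intros y. unfold E.
      pose proof (pow2_ge_0 (u y - w y)). pose proof (pow2_ge_0 (u1 y - w1 y)). lra.
    - intros y _. unfold E.
      specialize (Hu y). specialize (Hu1 y). specialize (Hw y). specialize (Hw1 y).
      auto_derive.
      + repeat split; eexists; eassumption.
      + rewrite (is_derive_unique (fun x : R => u x) _ _ Hu),
          (is_derive_unique (fun x : R => w x) _ _ Hw),
          (is_derive_unique (fun x : R => u1 x) _ _ Hu1),
          (is_derive_unique (fun x : R => w1 x) _ _ Hw1). ring.
    - intros y Hy. specialize (Hb y Hy). unfold E.
      rewrite <- (pow2_abs (u y - w y)), <- (pow2_abs (u1 y - w1 y)).
      eapply Rle_trans; [apply Rabs_triang|].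
      rewrite !Rabs_mult, (Rabs_pos_eq 2) by lra.
      revert Hb. generalize (Rabs_pos (u y - w y)), (Rabs_pos (u1 y - w1 y)),
        (Rabs_pos (u2 y - w2 y)).
      generalize (Rabs (u y - w y)), (Rabs (u1 y - w1 y)), (Rabs (u2 y - w2 y)).
      intros a b c Ha Hb Hc Hcb.
      assert (2 * b * c <= 2 * b * (L * a + eta)) by (apply Rmult_le_compat_l; lra).
      assert (2 * a * b <= a ^ 2 + b ^ 2) by (pose proof (pow2_ge_0 (a - b)); lra).
      assert (L * (2 * a * b) <= L * (a ^ 2 + b ^ 2)) by (apply Rmult_le_compat_l; lra).
      assert (2 * b * eta <= b ^ 2 + eta ^ 2) by (pose proof (pow2_ge_0 (b - eta)); lra).
      assert (0 <= L * eta ^ 2) by (apply Rmult_le_pos; [lra | apply pow2_ge_0]).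
      pose proof (pow2_ge_0 a). pose proof (pow2_ge_0 eta). lra. }
  unfold E in HE. pose proof (pow2_ge_0 (u1 x - w1 x)). lra.
Qed.

(** * Crossings and extrema *)

(** The point is the last one at which [f <= y]; the sign of the slope selects
    the increasing transition layer. *)
Lemma last_upcrossing (f df : R -> R) (a b y : R) :
  a <= b -> (forall x, is_derive f x (df x)) -> f a < y < f b ->
  exists s, f s = y /\ 0 <= df s.
Proof.
  intros Hab Hd Hy.
  assert (Hc : forall x e, 0 < e -> exists d, 0 < d /\
             forall z, Rabs (z - x) < d -> Rabs (f z - f x) < e).
  { intros x e. apply continuous_epsilon_delta.
    apply (ex_derive_continuous f). eexists; apply Hd. }
  destruct (completeness (fun x => x <= b /\ f x <= y)) as [s [Hub Hlub]].
  { exists b. intros x [Hx _]; exact Hx. }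
  { exists a. split; lra. }
  assert (Hsb : s <= b) by (apply Hlub; intros x [Hx _]; exact Hx).
  assert (Hright : forall x, s < x <= b -> y < f x).
  { intros x Hx. destruct (Rlt_dec y (f x)) as [h|h]; [exact h|].
    assert (x <= s) by (apply Hub; split; lra). lra. }
  assert (Hle : f s <= y).
  { destruct (Rle_dec (f s) y) as [h|h]; [exact h|].
    destruct (Hc s (f s - y) ltac:(lra)) as [d [Hd0 Hdl]].
    assert (s <= s - d).
    { apply Hlub. intros x [Hx Hfx].
      destruct (Rle_dec x (s - d)) as [h'|h']; [exact h'|].
      assert (x <= s) by (apply Hub; split; assumption).
      specialize (Hdl x ltac:(apply Rabs_def1; lra)).
      apply Rabs_def2 in Hdl. lra. }
    lra. }
  assert (Hlt : s < b) by (destruct (Rle_lt_or_eq_dec s b Hsb); subst; lra).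
  assert (Hfs : f s = y).
  { destruct (Rle_lt_or_eq_dec _ _ Hle) as [h|h]; [|exact h].
    destruct (Hc s (y - f s) ltac:(lra)) as [d [Hd0 Hdl]].
    pose proof (Rmin_l (d / 2) (b - s)). pose proof (Rmin_r (d / 2) (b - s)).
    assert (0 < Rmin (d / 2) (b - s)) by (apply Rmin_glb_lt; lra).
    specialize (Hdl (s + Rmin (d / 2) (b - s)) ltac:(apply Rabs_def1; lra)).
    specialize (Hright (s + Rmin (d / 2) (b - s)) ltac:(lra)).
    apply Rabs_def2 in Hdl. lra. }
  exists s. split; [exact Hfs|].
  destruct (Rle_dec 0 (df s)) as [h|h]; [exact h|].
  pose proof (proj1 (is_derive_Reals f s (df s)) (Hd s)) as D.
  destruct (D (- df s) ltac:(lra)) as [d Hdl].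
  pose proof (Rmin_l (d / 2) (b - s)). pose proof (Rmin_r (d / 2) (b - s)).
  pose proof (cond_pos d).
  assert (0 < Rmin (d / 2) (b - s)) by (apply Rmin_glb_lt; lra).
  set (k := Rmin (d / 2) (b - s)) in *.
  specialize (Hdl k ltac:(lra) ltac:(apply Rabs_def1; lra)).
  specialize (Hright (s + k) ltac:(lra)).
  apply Rabs_def2 in Hdl. destruct Hdl as [Hdl _].
  assert (0 < (f (s + k) - f s) / k) by (apply Rdiv_lt_0_compat; lra). lra.
Qed.

Lemma periodic1_shift (f : R -> R) (n : nat) (x : R) :
  periodic1 f -> f (x + INR n) = f x.
Proof.
  intros Hp. induction n as [|n IH].
  - simpl. now rewrite Rplus_0_r.
  - rewrite S_INR, <- Rplus_assoc, Hp. exact IH.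
Qed.

Lemma periodic1_representative (f : R -> R) (x : R) :
  periodic1 f -> exists y, 0 <= y <= 1 /\ f y = f x.
Proof.
  intros Hp. destruct (archimed x) as [H1 H2].
  exists (x - IZR (up x) + 1). split; [lra|].
  rewrite Hp.
  destruct (Z_le_dec 0 (up x)) as [h|h].
  - rewrite <- (periodic1_shift f (Z.to_nat (up x))) by exact Hp.
    rewrite INR_IZR_INZ, Z2Nat.id by exact h. f_equal; ring.
  - rewrite <- (periodic1_shift f (Z.to_nat (- up x)) x) by exact Hp.
    rewrite INR_IZR_INZ, Z2Nat.id by lia. rewrite opp_IZR. f_equal; ring.
Qed.

Lemma periodic1_extrema (f df : R -> R) :
  periodic1 f -> (forall x, is_derive f x (df x)) ->
  exists a b, a <= b /\ (forall x, f a <= f x <= f b) /\ df a = 0 /\ df b = 0.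
Proof.
  intros Hp Hd.
  assert (Hc : forall x, 0 <= x <= 1 -> continuity_pt f x).
  { intros x _. apply continuity_pt_filterlim.
    apply (ex_derive_continuous f). eexists; apply Hd. }
  destruct (continuity_ab_min f 0 1 ltac:(lra) Hc) as [a [Ha Ha']].
  destruct (continuity_ab_maj f 0 1 ltac:(lra) Hc) as [b [Hb Hb']].
  assert (Hall : forall x, f a <= f x <= f b).
  { intros x. destruct (periodic1_representative f x Hp) as [y [Hy <-]]. auto. }
  assert (Hder : forall c, (forall x, f c <= f x) \/ (forall x, f x <= f c) -> df c = 0).
  { intros c Hcc.
    assert (pr : derivable_pt f c)
      by (exists (df c); apply is_derive_Reals, Hd).
    replace (df c) with (derive_pt f c pr)
      by (apply derive_pt_eq_0, is_derive_Reals, Hd).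
    destruct Hcc as [h|h].
    - apply deriv_minimum with (c - 1) (c + 1); try lra. auto.
    - apply deriv_maximum with (c - 1) (c + 1); try lra. auto. }
  exists a, (b + 1). rewrite Hp. repeat split; try lra; try apply Hall.
  - apply Hder. left; intros; apply Hall.
  - apply Hder. right; intros; rewrite Hp; apply Hall.
Qed.


(** * Two-phase limits *)

Lemma two_valued_constant (v : R -> R) (g l p q : R) :
  (forall x, v x = g \/ v x = l) ->
  (forall x, p < x < q -> continuous v x) ->
  forall x y, p < x < q -> p < y < q -> v x = v y.
Proof.
  intros Hv Hc.
  assert (Hlt : forall x y, p < x < q -> p < y < q -> x < y -> v x = v y).
  { intros x y Hx Hy Hxy.
    destruct (Req_dec (v x) (v y)) as [h|h]; [exact h|exfalso].
    destruct (Ranalysis5.IVT_interv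
      (fun t => (v t - (v x + v y) / 2) * (v y - v x)) x y) as [t [Ht E]].
    - intros t Ht. apply continuity_pt_filterlim.
      apply (continuous_mult (fun t => v t - (v x + v y) / 2) (fun _ => v y - v x)).
      + apply (continuous_minus v (fun _ => (v x + v y) / 2)).
        * apply Hc; lra.
        * apply continuous_const.
      + apply continuous_const.
    - exact Hxy.
    - destruct (Rdichotomy _ _ h); nra.
    - destruct (Rdichotomy _ _ h); nra.
    - apply Rmult_integral in E.
      destruct (Hv t), (Hv x), (Hv y); lra. }
  intros x y Hx Hy. destruct (Rtotal_order x y) as [h|[h|h]].
  - auto.
  - now rewrite h.
  - symmetry; auto.
Qed.

(** Only interior values of [v] matter, so nothing is required at the ends. *)
Lemma ex_RInt_const_on (v f : R -> R) (k p q : R) :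
  p <= q -> (forall x, continuous f x) ->
  (forall x, p < x < q -> v x = k) ->
  ex_RInt (fun x => Rabs (f x - v x)) p q.
Proof.
  intros Hpq Hf Hv.
  apply ex_RInt_ext with (fun x => Rabs (f x - k)).
  - intros x. rewrite Rmin_left, Rmax_right by exact Hpq.
    intros Hx. now rewrite Hv.
  - apply (ex_RInt_continuous (V := R_CompleteNormedModule)). intros x _.
    apply (continuous_comp (fun x => f x - k) Rabs); [|apply continuous_Rabs].
    apply (continuous_minus f (fun _ => k)); [apply Hf | apply continuous_const].
Qed.

(** A function that is close in mean to [v] is close to [k] somewhere on an
    interval where [v] equals [k]. *)
Lemma exists_near_of_RInt (v f : R -> R) (k p q S : R) :
  0 <= p -> p < q -> q <= 1 ->
  ex_RInt (fun x => Rabs (f x - v x)) 0 1 ->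
  (forall x, p < x < q -> v x = k) ->
  RInt (fun x => Rabs (f x - v x)) 0 1 < S * (q - p) ->
  exists x, Rabs (f x - k) < S.
Proof.
  intros Hp Hpq Hq Hex Hv HS.
  destruct (classic (exists x, Rabs (f x - k) < S)) as [h|h]; [exact h|exfalso].
  assert (Hge : forall x, S <= Rabs (f x - k)).
  { intros x. apply Rnot_lt_le. intros H. apply h. now exists x. }
  set (F := fun x => Rabs (f x - v x)) in *.
  assert (E1 : ex_RInt F 0 q) by (apply (ex_RInt_Chasles_1 F 0 q 1); [lra|exact Hex]).
  assert (E2 : ex_RInt F q 1) by (apply (ex_RInt_Chasles_2 F 0 q 1); [lra|exact Hex]).
  assert (E3 : ex_RInt F 0 p) by (apply (ex_RInt_Chasles_1 F 0 p q); [lra|exact E1]).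
  assert (E4 : ex_RInt F p q) by (apply (ex_RInt_Chasles_2 F 0 p q); [lra|exact E1]).
  pose proof (RInt_Chasles F 0 p q E3 E4) as C1.
  pose proof (RInt_Chasles F 0 q 1 E1 E2) as C2.
  unfold plus in C1, C2; simpl in C1, C2.
  assert (P1 : 0 <= RInt F 0 p)
    by (apply RInt_ge_0; auto; intros; apply Rabs_pos).
  assert (P2 : 0 <= RInt F q 1)
    by (apply RInt_ge_0; auto; intros; apply Rabs_pos).
  assert (P3 : RInt (fun _ => S) p q <= RInt F p q).
  { apply RInt_le; auto; [lra | apply ex_RInt_const |].
    intros x Hx. unfold F. rewrite Hv by exact Hx. apply Hge. }
  rewrite RInt_const in P3. unfold scal in P3; simpl in P3; unfold mult in P3; simpl in P3.
  lra.
Qed.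

(** Of the two jumps only the second is used: it lies inside [(0, 1)], and [v]
    takes the two phases on the intervals on either side of it. *)
Lemma two_phase_limit_values (g l eps0 : R) (rho : R -> R -> R) :
  0 < eps0 ->
  (forall e, 0 < e < eps0 -> forall x, continuous (rho e) x) ->
  two_phase_limit g l rho ->
  forall eta, 0 < eta -> exists e1, 0 < e1 /\
    forall e, 0 < e < e1 ->
      (exists x, Rabs (rho e x - g) < eta) /\ (exists x, Rabs (rho e x - l) < eta).
Proof.
  intros He0 Hcont [v [_ [Hv [[a [b [Ha [Hab [Hb [_ [Hjb Hc]]]]]]] Hlim]]]] eta Heta.
  set (k1 := v ((a + b) / 2)). set (k2 := v ((b + 1) / 2)).
  assert (H0 : forall x, 0 < x < a -> v x = v (a / 2)).
  { intros x Hx. apply (two_valued_constant v g l 0 a Hv); try lra.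
    intros z Hz. apply Hc; lra. }
  assert (H1 : forall x, a < x < b -> v x = k1).
  { intros x Hx. apply (two_valued_constant v g l a b Hv); try lra.
    intros z Hz. apply Hc; lra. }
  assert (H2 : forall x, b < x < 1 -> v x = k2).
  { intros x Hx. apply (two_valued_constant v g l b 1 Hv); try lra.
    intros z Hz. apply Hc; lra. }
  (* otherwise the one-sided limits at the jump [b] would agree *)
  assert (Hk : k1 <> k2).
  { intros Heq. destruct Hjb as [vl [vr [Hne [Hl Hr]]]]. apply Hne.
    transitivity k1; [|rewrite Heq].
    - apply (filterlim_locally_unique (K := R_AbsRing) (V := R_NormedModule)
        (F := at_left b) v vl k1 Hl).
      apply filterlim_ext_loc with (fun _ => k1); [|apply filterlim_const].
      exists (mkposreal (b - a) ltac:(lra)). intros y Hy Hyb.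
      apply Rabs_def2 in Hy. simpl in Hy. unfold minus, plus, opp in Hy; simpl in Hy.
      symmetry; apply H1; lra.
    - symmetry. apply (filterlim_locally_unique (K := R_AbsRing) (V := R_NormedModule)
        (F := at_right b) v vr k2 Hr).
      apply filterlim_ext_loc with (fun _ => k2); [|apply filterlim_const].
      exists (mkposreal (1 - b) ltac:(lra)). intros y Hy Hyb.
      apply Rabs_def2 in Hy. simpl in Hy. unfold minus, plus, opp in Hy; simpl in Hy.
      symmetry; apply H2; lra. }
  set (th := Rmin (b - a) (1 - b)).
  assert (Hth : 0 < th) by (apply Rmin_glb_lt; lra).
  pose proof (Rmin_l (b - a) (1 - b)) as Hth1. pose proof (Rmin_r (b - a) (1 - b)) as Hth2.
  fold th in Hth1, Hth2.
  assert (Hpos : 0 < eta * th) by (apply Rmult_lt_0_compat; lra).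
  destruct (proj1 (filterlim_locally _ _) Hlim (mkposreal _ Hpos)) as [d Hd].
  exists (Rmin d eps0). split; [apply Rmin_glb_lt; [apply cond_pos|lra]|].
  intros e He. pose proof (Rmin_l d eps0). pose proof (Rmin_r d eps0).
  assert (Hee : 0 < e < eps0) by lra.
  (* needed because [RInt] carries no information on non-integrable functions *)
  assert (Hex : ex_RInt (fun x => Rabs (rho e x - v x)) 0 1).
  { apply ex_RInt_Chasles with b; [apply ex_RInt_Chasles with a|].
    - apply ex_RInt_const_on with (v (a / 2)); auto.
    - apply ex_RInt_const_on with k1; auto; lra.
    - apply ex_RInt_const_on with k2; auto; lra. }
  specialize (Hd e). simpl in Hd.
  assert (HS : RInt (fun x => Rabs (rho e x - v x)) 0 1 < eta * th).
  { assert (B : ball 0 d e).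
    { apply Rabs_def1; unfold minus, plus, opp; simpl; lra. }
    specialize (Hd B ltac:(lra)). apply Rabs_def2 in Hd.
    unfold minus, plus, opp in Hd; simpl in Hd. lra. }
  assert (N1 : exists x, Rabs (rho e x - k1) < eta).
  { apply (exists_near_of_RInt v (rho e) k1 a b); auto; try lra.
    assert (eta * th <= eta * (b - a)) by (apply Rmult_le_compat_l; lra). lra. }
  assert (N2 : exists x, Rabs (rho e x - k2) < eta).
  { apply (exists_near_of_RInt v (rho e) k2 b 1); auto; try lra.
    assert (eta * th <= eta * (1 - b)) by (apply Rmult_le_compat_l; lra). lra. }
  assert (K1 : k1 = g \/ k1 = l) by apply Hv.
  assert (K2 : k2 = g \/ k2 = l) by apply Hv.
  destruct K1 as [K1|K1], K2 as [K2|K2]; rewrite K1 in Hk, N1; rewrite K2 in Hk, N2;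
    first [now contradict Hk | split; assumption].
Qed.

(** * The double-well potential *)

(** [F] is a nonnegative potential between [g] and [l], with derivatives [F1] and [F2]
    on the positive half-line, vanishing together with its derivative at the
    two wells [g] and [l] and positive between them.  The wells may be
    degenerate. *)
Record C2_double_well (F F1 F2 : R -> R) (g l : R) : Prop := {
  well_order : 0 < g < l;
  well_derive1 : forall r, 0 < r -> is_derive F r (F1 r);
  well_derive2 : forall r, 0 < r -> is_derive F1 r (F2 r);
  well_continuous2 : forall r, 0 < r -> continuous F2 r;
  well_zero_g : F g = 0;
  well_zero_l : F l = 0;
  well_crit_g : F1 g = 0;
  well_crit_l : F1 l = 0;
  well_pos : forall r, g < r < l -> 0 < F r
}.

Lemma Psi_m_derivatives (Psi : R -> R) (m : R) :
  C2_pos Psi -> forall r, 0 < r ->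
  is_derive (Psi_m Psi m) r (Derive Psi r + m ^ 2 / (2 * r ^ 2)) /\
  is_derive (fun r => Derive Psi r + m ^ 2 / (2 * r ^ 2)) r
    (Derive_n Psi 2 r - m ^ 2 / r ^ 3) /\
  continuous (fun r => Derive_n Psi 2 r - m ^ 2 / r ^ 3) r.
Proof.
  intros H r Hr. destruct (H r Hr) as [H1 [H2 H3]]. split; [|split].
  - unfold Psi_m. auto_derive.
    + repeat split; [exact H1|lra].
    + change (Derive (fun x : R => Psi x) r) with (Derive Psi r). field; lra.
  - change (Derive_n Psi 2 r) with (Derive (fun x : R => Derive Psi x) r).
    auto_derive.
    + split; [exact H2|]. split; [|exact I]. nra.
    + change (Derive (fun x : R => Derive (fun y : R => Psi y) x) r)
        with (Derive (fun x : R => Derive Psi x) r). field; lra.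
  - apply (continuous_minus (Derive_n Psi 2) (fun r => m ^ 2 / r ^ 3)); [exact H3|].
    apply (ex_derive_continuous (fun r => m ^ 2 / r ^ 3)).
    auto_derive. apply Rgt_not_eq. pose proof (pow_lt r 3 Hr). simpl in *; lra.
Qed.

(** The potential is the height of the graph of [Psi_m] above the bitangent
    line; it is [W] in the original density variable. *)
Lemma bitangent_double_well (Psi : R -> R) (m g l : R) :
  C2_pos Psi -> bitangent (Psi_m Psi m) g l ->
  C2_double_well
    (fun r => Psi_m Psi m r - tangent_line (Psi_m Psi m) g r)
    (fun r => Derive Psi r + m ^ 2 / (2 * r ^ 2) - Derive (Psi_m Psi m) g)
    (fun r => Derive_n Psi 2 r - m ^ 2 / r ^ 3) g l.
Proof.
  intros HPsi [Hgl [Ht [eta [Heta Hpos]]]].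
  pose proof (Psi_m_derivatives Psi m HPsi) as HD.
  assert (Hslope : Derive (Psi_m Psi m) g = Derive (Psi_m Psi m) l).
  { pose proof (Ht 0) as T0. pose proof (Ht 1) as T1.
    unfold tangent_line in T0, T1. lra. }
  assert (HDv : forall r, 0 < r ->
    Derive (Psi_m Psi m) r = Derive Psi r + m ^ 2 / (2 * r ^ 2)).
  { intros r Hr. exact (is_derive_unique _ _ _ (proj1 (HD r Hr))). }
  constructor.
  - exact Hgl.
  - intros r Hr. unfold tangent_line.
    apply (is_derive_minus (Psi_m Psi m)); [exact (proj1 (HD r Hr))|].
    auto_derive; [exact I|ring].
  - intros r Hr.
    replace (Derive_n Psi 2 r - m ^ 2 / r ^ 3)
      with (minus (Derive_n Psi 2 r - m ^ 2 / r ^ 3) 0)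
      by (unfold minus, plus, opp; simpl; ring).
    apply (is_derive_minus (fun r => Derive Psi r + m ^ 2 / (2 * r ^ 2))
      (fun _ => Derive (Psi_m Psi m) g)); [apply HD, Hr|].
    apply @is_derive_const.
  - intros r Hr. apply HD, Hr.
  - unfold tangent_line; ring.
  - rewrite Ht. unfold tangent_line; ring.
  - rewrite HDv by lra. ring.
  - rewrite Hslope, HDv by lra. ring.
  - intros r Hr. specialize (Hpos r ltac:(lra) ltac:(lra) ltac:(lra)). lra.
Qed.

(** * First integrals of the Euler-Korteweg equation *)

Lemma is_derive_pressure (Psi : R -> R) (r : R) :
  C2_pos Psi -> 0 < r -> is_derive (pressure Psi) r (r * Derive_n Psi 2 r).
Proof.
  intros H Hr. destruct (H r Hr) as [H1 [H2 _]].
  unfold pressure.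
  change (Derive_n Psi 2 r) with (Derive (fun x : R => Derive Psi x) r).
  auto_derive.
  - repeat split; assumption.
  - change (fun x => Psi x) with Psi. ring.
Qed.

(** Every term of the equation carries a factor [rho], since the derivative of
    the pressure is [rho * Psi'']; without it the equation equates [e] times the
    third derivative of [rho] with the derivative of [Psi_m' (rho)]. *)
Lemma korteweg_equation_iff (Psi rho : R -> R) (m e d1 d3 x : R) :
  C2_pos Psi -> 0 < rho x -> is_derive rho x d1 ->
  is_derive (Derive_n rho 2) x d3 ->
  (Derive (fun y => m ^ 2 / rho y) x + Derive (fun y => pressure Psi (rho y)) x
     = rho x * Derive (fun y => e * Derive_n rho 2 y) x
   <-> e * d3 = (Derive_n Psi 2 (rho x) - m ^ 2 / rho x ^ 3) * d1).
Proof.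
  intros HPsi Hpos H1 H3.
  assert (E1 : Derive (fun y => m ^ 2 / rho y) x = - m ^ 2 * d1 / rho x ^ 2).
  { apply is_derive_unique. auto_derive.
    - repeat split; [eexists; exact H1 | lra].
    - rewrite (is_derive_unique (fun x : R => rho x) _ _ H1). field. lra. }
  assert (E2 : Derive (fun y => pressure Psi (rho y)) x
               = d1 * (rho x * Derive_n Psi 2 (rho x))).
  { apply is_derive_unique.
    apply (is_derive_comp (pressure Psi) rho); [|exact H1].
    now apply is_derive_pressure. }
  assert (E3 : Derive (fun y => e * Derive_n rho 2 y) x = e * d3).
  { rewrite Derive_scal. f_equal. now apply is_derive_unique. }
  rewrite E1, E2, E3.
  replace (- m ^ 2 * d1 / rho x ^ 2 + d1 * (rho x * Derive_n Psi 2 (rho x)))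
    with (rho x * ((Derive_n Psi 2 (rho x) - m ^ 2 / rho x ^ 3) * d1)) by (field; lra).
  split; intros E.
  - apply Rmult_eq_reg_l with (rho x); lra.
  - rewrite E. reflexivity.
Qed.

(** The once and twice integrated form of the equation: [u] has derivatives
    [u1] and [u2], solves Newton's equation in the force field [F1 + c], and has
    the conserved energy.  The constants [c] and [d] are those of the two
    integrations. *)
Definition profile_equations (F F1 : R -> R) (e c d : R) (u u1 u2 : R -> R) : Prop :=
  (forall x, is_derive u x (u1 x)) /\
  (forall x, is_derive u1 x (u2 x)) /\
  (forall x, e * u2 x = F1 (u x) + c) /\
  (forall x, e / 2 * u1 x ^ 2 = F (u x) + c * u x + d).

Lemma korteweg_first_integrals (Psi F F1 : R -> R) (m g l e : R) (rho : R -> R) :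
  C2_pos Psi ->
  C2_double_well F F1 (fun r => Derive_n Psi 2 r - m ^ 2 / r ^ 3) g l ->
  korteweg_solution Psi m e rho ->
  exists c d, profile_equations F F1 e c d rho (Derive rho) (Derive_n rho 2).
Proof.
  intros HPsi HF [Hpos [Hex Heq]].
  assert (D1 : forall x, is_derive rho x (Derive rho x)).
  { intros x. apply Derive_correct. exact (Hex 1%nat x ltac:(lia)). }
  assert (D2 : forall x, is_derive (Derive rho) x (Derive_n rho 2 x)).
  { intros x. apply (Derive_correct (Derive rho)). exact (Hex 2%nat x ltac:(lia)). }
  assert (D3 : forall x, is_derive (Derive_n rho 2) x (Derive_n rho 3 x)).
  { intros x. apply (Derive_correct (Derive_n rho 2)). exact (Hex 3%nat x ltac:(lia)). }
  assert (DF1 : forall x, is_derive (fun y => F1 (rho y)) x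
     (Derive rho x * (Derive_n Psi 2 (rho x) - m ^ 2 / rho x ^ 3))).
  { intros x. apply (is_derive_comp F1 rho); [|apply D1].
    apply (well_derive2 _ _ _ _ _ HF), Hpos. }
  set (c := e * Derive_n rho 2 0 - F1 (rho 0)).
  assert (E1 : forall x, e * Derive_n rho 2 x = F1 (rho x) + c).
  { intros x.
    pose proof (constant_of_zero_derive
      (fun y => e * Derive_n rho 2 y - F1 (rho y))) as K.
    unfold c. rewrite <- (K) with (x := x); [ring|]. clear x.
    intros x.
    pose proof (proj1 (korteweg_equation_iff Psi rho m e _ _ x HPsi (Hpos x) (D1 x) (D3 x))
      (Heq x)) as E.
    pose proof (D3 x) as D3x. pose proof (DF1 x) as DF1x.
    replace 0 with (minus (e * Derive_n rho 3 x)
      (Derive rho x * (Derive_n Psi 2 (rho x) - m ^ 2 / rho x ^ 3))).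
    2: { rewrite E. unfold minus, plus, opp; simpl. ring. }
    apply (is_derive_minus (fun y => e * Derive_n rho 2 y)); [|exact DF1x].
    now apply (is_derive_scal (Derive_n rho 2)). }
  set (d := e / 2 * Derive rho 0 ^ 2 - F (rho 0) - c * rho 0).
  exists c, d. refine (conj D1 (conj D2 (conj E1 _))).
  intros x.
  pose proof (constant_of_zero_derive
      (fun y => e / 2 * Derive rho y ^ 2 - F (rho y) - c * rho y)) as K.
  unfold d. rewrite <- (K) with (x := x); [ring|]. clear x.
  intros x.
  pose proof (D1 x) as A1. pose proof (D2 x) as A2. 
  pose proof (well_derive1 _ _ _ _ _ HF _ (Hpos x)) as A3.
  auto_derive.
  - repeat split; eexists; eassumption.
  - change (Derive (fun x : R => Derive rho x) x) with (Derive_n rho 2 x).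
    change (Derive (fun x : R => rho x) x) with (Derive rho x).
    change (Derive (fun x : R => F x) (rho x)) with (Derive F (rho x)).
    rewrite (is_derive_unique F (rho x) _ A3).
    specialize (E1 x).
    replace (F1 (rho x)) with (e * Derive_n rho 2 x - c) by lra. field.
Qed.

(** * The heteroclinic profile *)

(** The inverse of a strictly increasing bijection [T] from the open interval
    [(g, l)] onto the line, with its derivative. *)
Lemma strictly_increasing_inverse (T h : R -> R) (g l : R) :
  (forall r, g < r < l -> is_derive T r (h r)) ->
  (forall r, g < r < l -> 0 < h r) ->
  (forall r, g < r < l -> continuous h r) ->
  (forall x, exists r, g < r < l /\ T r = x) ->
  exists rho : R -> R,
    (forall x, g < rho x < l) /\ (forall r, g < r < l -> rho (T r) = r) /\
    (forall x y, x < y -> rho x < rho y) /\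
    (forall x, is_derive rho x (/ h (rho x))).
Proof.
  intros HT Hh Hc Hsurj.
  destruct (functional_choice _ Hsurj) as [rho Hrho].
  assert (Hr : forall x, g < rho x < l) by (intros; apply Hrho).
  assert (HTr : forall x, T (rho x) = x) by (intros; apply Hrho).
  assert (Hmvt : forall r s, g < r < l -> g < s < l ->
    exists c, Rmin r s <= c <= Rmax r s /\ T s - T r = h c * (s - r)).
  { intros r s H1 H2. apply mvt_is_derive. intros x Hx. apply HT. revert Hx.
    unfold Rmin, Rmax. destruct (Rle_dec r s); lra. }
  assert (Hin : forall r s c, g < r < l -> g < s < l ->
    Rmin r s <= c <= Rmax r s -> g < c < l).
  { intros r s c. unfold Rmin, Rmax. destruct (Rle_dec r s); lra. }
  assert (Hmono : forall x y, x < y -> rho x < rho y).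
  { intros x y Hxy. destruct (Hmvt (rho x) (rho y) (Hr x) (Hr y)) as [c [H1 H2]].
    rewrite !HTr in H2.
    pose proof (Hh c (Hin _ _ _ (Hr x) (Hr y) H1)). nra. }
  exists rho. split; [exact Hr|]. split.
  { intros r H. destruct (Rtotal_order (rho (T r)) r) as [h1|[h1|h1]]; [|exact h1|];
    destruct (Hmvt (rho (T r)) r (Hr _) H) as [c [H1 H2]]; rewrite HTr in H2;
    pose proof (Hh c (Hin _ _ _ (Hr _) H H1)); nra. }
  split; [exact Hmono|].
  intros x. apply is_derive_Reals. intros e He.
  assert (Cinv : continuous (fun s => / h s) (rho x)).
  { apply continuous_comp; [now apply Hc, Hr|].
    apply continuous_Rinv. apply Rgt_not_eq, Hh, Hr. }
  destruct (continuous_epsilon_delta _ _ e Cinv He) as [d1 [Hd1 Hd1']].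
  set (d2 := Rmin (d1 / 2) (Rmin ((rho x - g) / 2) ((l - rho x) / 2))).
  pose proof (Hr x) as Hrx.
  assert (0 < d2) by (repeat apply Rmin_glb_lt; lra).
  assert (d2 <= d1 / 2) by apply Rmin_l.
  assert (d2 <= (rho x - g) / 2)
    by (eapply Rle_trans; [apply Rmin_r | apply Rmin_l]).
  assert (d2 <= (l - rho x) / 2)
    by (eapply Rle_trans; [apply Rmin_r | apply Rmin_r]).
  assert (Tmono : forall r s, g < r < l -> g < s < l -> r < s -> T r < T s).
  { intros r s Hgr Hgs Hrs. destruct (Hmvt r s Hgr Hgs) as [c [Hcrs Ec]].
    pose proof (Hh c (Hin _ _ _ Hgr Hgs Hcrs)). nra. }
  pose proof (Tmono (rho x - d2) (rho x) ltac:(lra) ltac:(lra) ltac:(lra)) as M1.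
  pose proof (Tmono (rho x) (rho x + d2) ltac:(lra) ltac:(lra) ltac:(lra)) as M2.
  rewrite HTr in M1, M2.
  assert (Hd3 : 0 < Rmin (x - T (rho x - d2)) (T (rho x + d2) - x))
    by (apply Rmin_glb_lt; lra).
  exists (mkposreal _ Hd3). simpl. intros k Hk Hk'.
  pose proof (Rmin_l (x - T (rho x - d2)) (T (rho x + d2) - x)).
  pose proof (Rmin_r (x - T (rho x - d2)) (T (rho x + d2) - x)).
  apply Rabs_def2 in Hk'.
  assert (B : rho x - d2 < rho (x + k) < rho x + d2).
  { pose proof (Hr (x + k)). split; apply Rnot_le_lt; intros [h1|h1].
    - apply Tmono in h1; try lra. rewrite HTr in h1. lra.
    - rewrite <- h1, HTr in *. lra.
    - apply Tmono in h1; try lra. rewrite HTr in h1. lra.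
    - rewrite h1, HTr in *. lra. }
  destruct (Hmvt (rho x) (rho (x + k)) (Hr x) (Hr _)) as [c [H1' H2']].
  rewrite !HTr in H2'.
  pose proof (Hh c (Hin _ _ _ (Hr x) (Hr _) H1')) as Hhc.
  (* the difference quotient is [/ h c] for some [c] between the two values *)
  replace ((rho (x + k) - rho x) / k) with (/ h c).
  - apply Hd1'. apply Rabs_def1; revert H1'; unfold Rmin, Rmax;
      destruct (Rle_dec (rho x) (rho (x + k))); lra.
  - assert (Hne : rho (x + k) - rho x <> 0).
    { intros h0. rewrite h0 in H2'. lra. }
    replace k with (h c * (rho (x + k) - rho x)) at 2 by lra.
    field. split; lra.
Qed.

(** The slope of an increasing profile of zero energy at the density [r]:
    [e / 2 * u' ^ 2 = F u] with [u' >= 0]. *)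
Definition well_speed (F : R -> R) (e r : R) : R := sqrt (2 / e * F r).

Lemma well_speed_pos (F F1 F2 : R -> R) (g l e r : R) :
  C2_double_well F F1 F2 g l -> 0 < e -> g < r < l -> 0 < well_speed F e r.
Proof.
  intros HF He Hr. apply sqrt_lt_R0. apply Rmult_lt_0_compat.
  - apply Rdiv_lt_0_compat; lra.
  - now apply (well_pos _ _ _ _ _ HF).
Qed.

Lemma is_derive_well_speed (F F1 F2 : R -> R) (g l e r : R) :
  C2_double_well F F1 F2 g l -> 0 < e -> g < r < l ->
  is_derive (well_speed F e) r (F1 r / (e * well_speed F e r)).
Proof.
  intros HF He Hr. pose proof (well_order _ _ _ _ _ HF).
  pose proof (well_speed_pos _ _ _ _ _ e r HF He Hr) as Hq.
  replace (F1 r / (e * well_speed F e r))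
    with ((2 / e * F1 r) / (2 * sqrt (2 / e * F r)))
    by (fold (well_speed F e r); field; lra).
  apply (is_derive_sqrt (fun s => 2 / e * F s)).
  - apply (is_derive_scal F). apply (well_derive1 _ _ _ _ _ HF). lra.
  - apply Rmult_lt_0_compat; [apply Rdiv_lt_0_compat; lra|].
    now apply (well_pos _ _ _ _ _ HF).
Qed.

Lemma continuous_inv_well_speed (F F1 F2 : R -> R) (g l e r : R) :
  C2_double_well F F1 F2 g l -> 0 < e -> g < r < l ->
  continuous (fun s => / well_speed F e s) r.
Proof.
  intros HF He Hr. apply (continuous_comp (well_speed F e) Rinv).
  - apply (ex_derive_continuous (well_speed F e)). eexists.
    apply (is_derive_well_speed _ _ _ _ _ e r HF He Hr).
  - apply continuous_Rinv, Rgt_not_eq, (well_speed_pos _ _ _ _ _ e r HF He Hr).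
Qed.

Lemma double_well_lipschitz (F F1 F2 : R -> R) (g l p q : R) :
  C2_double_well F F1 F2 g l -> 0 < p <= q ->
  exists L, 0 < L /\ forall x y, p <= x <= q -> p <= y <= q ->
    Rabs (F1 x - F1 y) <= L * Rabs (x - y).
Proof.
  intros HF Hpq. apply lipschitz_of_C1 with F2.
  - lra.
  - intros x Hx. apply (well_derive2 _ _ _ _ _ HF). lra.
  - intros x Hx. apply (well_continuous2 _ _ _ _ _ HF). lra.
Qed.

(** At the wells the potential vanishes at least quadratically, whether or not
    they are degenerate. *)
Lemma double_well_quadratic (F F1 F2 : R -> R) (g l : R) :
  C2_double_well F F1 F2 g l ->
  exists L, 0 < L /\ forall r, g <= r <= l ->
    F r <= L * (r - g) ^ 2 /\ F r <= L * (l - r) ^ 2.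
Proof.
  intros HF. pose proof (well_order _ _ _ _ _ HF) as Hgl.
  destruct (double_well_lipschitz _ _ _ _ _ g l HF ltac:(lra)) as [L [HL Hlip]].
  exists L. split; [exact HL|]. intros r Hr.
  assert (HD : forall x, g <= x <= l -> is_derive F x (F1 x))
    by (intros x Hx; apply (well_derive1 _ _ _ _ _ HF); lra).
  split.
  - destruct (mvt_is_derive F F1 g r) as [c [Hc E]];
      rewrite ?Rmin_left, ?Rmax_right in * by lra; [intros; apply HD; lra|].
    rewrite (well_zero_g _ _ _ _ _ HF) in E.
    specialize (Hlip c g ltac:(lra) ltac:(lra)).
    rewrite (well_crit_g _ _ _ _ _ HF), (Rabs_pos_eq (c - g)) in Hlip by lra.
    pose proof (Rle_abs (F1 c - 0)).
    assert (F1 c <= L * (r - g)) by nra. nra.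
  - destruct (mvt_is_derive F F1 r l) as [c [Hc E]];
      rewrite ?Rmin_left, ?Rmax_right in * by lra; [intros; apply HD; lra|].
    rewrite (well_zero_l _ _ _ _ _ HF) in E.
    specialize (Hlip l c ltac:(lra) ltac:(lra)).
    rewrite (well_crit_l _ _ _ _ _ HF), (Rabs_pos_eq (l - c)) in Hlip by lra.
    pose proof (Rle_abs (0 - F1 c)).
    assert (- F1 c <= L * (l - r)) by nra. nra.
Qed.

(** Near a well at distance [a], the time spent per unit of density is at least
    a multiple of [/ a], so reaching the well takes infinitely long. *)
Lemma inverse_well_speed_bound (F : R -> R) (e L a r : R) :
  0 < e -> 0 < a -> 0 < F r -> F r <= L * a ^ 2 ->
  / sqrt (2 / e * L) * / a <= / well_speed F e r.
Proof.
  intros He Ha HF HL.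
  assert (H2 : 0 < 2 / e) by (apply Rdiv_lt_0_compat; lra).
  assert (HLp : 0 < L).
  { apply Rnot_le_lt. intros h. pose proof (pow2_ge_0 a). nra. }
  rewrite <- Rinv_mult. apply Rinv_le_contravar.
  - apply sqrt_lt_R0, Rmult_lt_0_compat; assumption.
  - replace (sqrt (2 / e * L) * a) with (sqrt (2 / e * L * a ^ 2)).
    + apply sqrt_le_1_alt. rewrite Rmult_assoc.
      apply Rmult_le_compat_l; lra.
    + rewrite sqrt_mult.
      * now rewrite sqrt_pow2 by lra.
      * apply Rlt_le, Rmult_lt_0_compat; assumption.
      * apply pow2_ge_0.
Qed.

(** [T r] is the time an increasing zero-energy profile takes from the midpoint
    to [r].  It is onto the line because the quadratic bound makes it diverge
    logarithmically at both wells. *)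
Lemma travel_time (F F1 F2 : R -> R) (g l e : R) :
  C2_double_well F F1 F2 g l -> 0 < e ->
  exists T : R -> R,
    T ((g + l) / 2) = 0 /\
    (forall r, g < r < l -> is_derive T r (/ well_speed F e r)) /\
    (forall x, exists r, g < r < l /\ T r = x).
Proof.
  intros HF He. pose proof (well_order _ _ _ _ _ HF) as Hgl.
  set (r0 := (g + l) / 2).
  assert (Hr0 : g < r0 < l) by (unfold r0; lra).
  set (h := fun r => / well_speed F e r).
  assert (Hhc : forall r, g < r < l -> continuous h r).
  { intros r Hr. now apply (continuous_inv_well_speed F F1 F2 g l). }
  set (T := (fun r => RInt h r0 r) : R -> R).
  assert (HT : forall r, g < r < l -> is_derive T r (h r)).
  { intros r Hr. apply (is_derive_RInt h T r0 r); [|now apply Hhc].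
    set (d := Rmin (r - g) (l - r)).
    assert (Hd : 0 < d) by (apply Rmin_glb_lt; lra).
    exists (mkposreal d Hd). intros s Hs.
    apply Rabs_def2 in Hs. simpl in Hs. unfold minus, plus, opp in Hs; simpl in Hs.
    pose proof (Rmin_l (r - g) (l - r)). pose proof (Rmin_r (r - g) (l - r)).
    fold d in H, H0.
    apply (RInt_correct (V := R_CompleteNormedModule)).
    apply (ex_RInt_continuous (V := R_CompleteNormedModule)).
    intros z Hz. apply Hhc. revert Hz. unfold Rmin, Rmax.
    destruct (Rle_dec r0 s); lra. }
  assert (HT0 : T r0 = 0) by apply (RInt_point (V := R_CompleteNormedModule)).
  destruct (double_well_quadratic _ _ _ _ _ HF) as [L [HL HFL]].
  set (k := / sqrt (2 / e * L)).
  assert (Hk : 0 < k).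
  { apply Rinv_0_lt_compat, sqrt_lt_R0, Rmult_lt_0_compat; [|exact HL].
    apply Rdiv_lt_0_compat; lra. }
  (* [T r - k * ln (r - g)] is nondecreasing, and [r] is chosen so that
     [ln (r - g)] drops by [n] *)
  assert (Hlow : forall n, 0 <= n -> T (g + (r0 - g) * exp (- n)) <= - (k * n)).
  { intros n Hn. pose proof (exp_pos (- n)).
    assert (exp (- n) <= 1).
    { rewrite <- exp_0. destruct Hn as [Hn|<-]; [|rewrite Ropp_0; lra].
      apply Rlt_le, exp_increasing; lra. }
    set (r := g + (r0 - g) * exp (- n)).
    assert (Hr : g < r <= r0) by (unfold r; nra).
    assert (M : T r - k * ln (r - g) <= T r0 - k * ln (r0 - g)).
    { apply (nondecreasing_is_derive (fun s => T s - k * ln (s - g))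
        (fun s => h s - k * / (s - g))).
      - lra.
      - intros s Hs. apply (is_derive_minus T (fun s => k * ln (s - g))).
        + apply HT; lra.
        + auto_derive; [lra | field; lra].
      - intros s Hs. enough (k * / (s - g) <= h s) by lra.
        apply inverse_well_speed_bound; try lra.
        + apply (well_pos _ _ _ _ _ HF); lra.
        + apply HFL; lra. }
    replace (ln (r - g)) with (ln (r0 - g) - n) in M.
    - rewrite HT0 in M. lra.
    - unfold r. replace (g + (r0 - g) * exp (- n) - g)
        with ((r0 - g) * exp (- n)) by ring.
      rewrite ln_mult, ln_exp by lra. ring. }
  assert (Hhigh : forall n, 0 <= n -> k * n <= T (l - (l - r0) * exp (- n))).
  { intros n Hn. pose proof (exp_pos (- n)).
    assert (exp (- n) <= 1).
    { rewrite <- exp_0. destruct Hn as [Hn|<-]; [|rewrite Ropp_0; lra].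
      apply Rlt_le, exp_increasing; lra. }
    set (r := l - (l - r0) * exp (- n)).
    assert (Hr : r0 <= r < l) by (unfold r; nra).
    assert (M : T r0 + k * ln (l - r0) <= T r + k * ln (l - r)).
    { apply (nondecreasing_is_derive (fun s => T s + k * ln (l - s))
        (fun s => h s + - (k * / (l - s)))).
      - lra.
      - intros s Hs. apply (is_derive_plus T (fun s => k * ln (l - s))).
        + apply HT; lra.
        + auto_derive; [lra | field; lra].
      - intros s Hs. enough (k * / (l - s) <= h s) by lra.
        apply inverse_well_speed_bound; try lra.
        + apply (well_pos _ _ _ _ _ HF); lra.
        + apply HFL; lra. }
    replace (ln (l - r)) with (ln (l - r0) - n) in M.
    - rewrite HT0 in M. lra.
    - unfold r. replace (l - (l - (l - r0) * exp (- n)))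
        with ((l - r0) * exp (- n)) by ring.
      rewrite ln_mult, ln_exp by lra. ring. }
  exists T. split; [exact HT0|]. split; [exact HT|].
  intros x. set (n := (Rabs x + 1) / k).
  assert (Hn : 0 < n) by (apply Rdiv_lt_0_compat; [pose proof (Rabs_pos x)|]; lra).
  assert (Hkn : k * n = Rabs x + 1) by (unfold n; field; lra).
  specialize (Hlow n ltac:(lra)). specialize (Hhigh n ltac:(lra)).
  rewrite Hkn in Hlow, Hhigh.
  assert (0 < exp (- n) < 1).
  { split; [apply exp_pos|]. rewrite <- exp_0. apply exp_increasing; lra. }
  set (ra := g + (r0 - g) * exp (- n)) in *.
  set (rb := l - (l - r0) * exp (- n)) in *.
  assert (Hra : g < ra < r0) by (unfold ra; nra).
  assert (Hrb : r0 < rb < l) by (unfold rb; nra).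
  destruct (Ranalysis5.IVT_interv (fun r => T r - x) ra rb) as [r [Hr E]].
  - intros r Hr. apply continuity_pt_filterlim.
    apply (continuous_minus T (fun _ => x)); [|apply continuous_const].
    apply (ex_derive_continuous T). exists (h r). apply HT; lra.
  - lra.
  - pose proof (Rabs_maj2 x). lra.
  - pose proof (Rle_abs x). lra.
  - exists r. split; lra.
Qed.

(** The translation is fixed by placing the midpoint density at the origin. *)
Lemma heteroclinic_exists (F F1 F2 : R -> R) (g l e : R) :
  C2_double_well F F1 F2 g l -> 0 < e ->
  exists rho : R -> R,
    rho 0 = (g + l) / 2 /\
    (forall x, g < rho x < l) /\
    (forall x y, x < y -> rho x < rho y) /\
    (forall x, is_derive rho x (well_speed F e (rho x))) /\
    is_lim rho m_infty g /\ is_lim rho p_infty l.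
Proof.
  intros HF He. pose proof (well_order _ _ _ _ _ HF) as Hgl.
  destruct (travel_time _ _ _ _ _ e HF He) as [T [HT0 [HT Hsurj]]].
  destruct (strictly_increasing_inverse T (fun r => / well_speed F e r) g l)
    as [rho [Hr [Hinv [Hmono Hder]]]]; auto.
  - intros r Hr. apply Rinv_0_lt_compat, (well_speed_pos _ _ _ _ _ e r HF He Hr).
  - intros r Hr. now apply (continuous_inv_well_speed F F1 F2 g l).
  - exists rho. repeat match goal with |- _ /\ _ => split end; auto.
    + rewrite <- HT0. apply Hinv; lra.
    + intros x. rewrite <- (Rinv_inv (well_speed F e (rho x))). apply Hder.
    + apply is_lim_spec. intros d.
      set (r := g + Rmin (d / 2) ((l - g) / 2)).
      pose proof (Rmin_l (d / 2) ((l - g) / 2)).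
      pose proof (Rmin_r (d / 2) ((l - g) / 2)).
      pose proof (cond_pos d).
      assert (0 < Rmin (d / 2) ((l - g) / 2)) by (apply Rmin_glb_lt; lra).
      exists (T r). intros x Hx. apply Hmono in Hx.
      rewrite Hinv in Hx by (unfold r; lra).
      specialize (Hr x). unfold r in Hx. apply Rabs_def1; lra.
    + apply is_lim_spec. intros d.
      set (r := l - Rmin (d / 2) ((l - g) / 2)).
      pose proof (Rmin_l (d / 2) ((l - g) / 2)).
      pose proof (Rmin_r (d / 2) ((l - g) / 2)).
      pose proof (cond_pos d).
      assert (0 < Rmin (d / 2) ((l - g) / 2)) by (apply Rmin_glb_lt; lra).
      exists (T r). intros x Hx. apply Hmono in Hx.
      rewrite Hinv in Hx by (unfold r; lra).
      specialize (Hr x). unfold r in Hx. apply Rabs_def1; lra.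
Qed.

Lemma heteroclinic_profile (F F1 F2 : R -> R) (g l e : R) (rho : R -> R) :
  C2_double_well F F1 F2 g l -> 0 < e ->
  (forall x, g < rho x < l) ->
  (forall x, is_derive rho x (well_speed F e (rho x))) ->
  profile_equations F F1 e 0 0 rho
    (fun x => well_speed F e (rho x)) (fun x => F1 (rho x) / e).
Proof.
  intros HF He Hr Hd. split; [exact Hd|]. split; [|split].
  - intros x. pose proof (well_speed_pos _ _ _ _ _ e _ HF He (Hr x)).
    replace (F1 (rho x) / e) with
      (well_speed F e (rho x) * (F1 (rho x) / (e * well_speed F e (rho x))))
      by (field; lra).
    apply (is_derive_comp (well_speed F e) rho); [|apply Hd].
    apply (is_derive_well_speed _ _ _ _ _ e _ HF He (Hr x)).
  - intros x. field. lra.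
  - intros x. unfold well_speed. rewrite pow2_sqrt.
    + field. lra.
    + apply Rmult_le_pos; [apply Rlt_le, Rdiv_lt_0_compat; lra|].
      apply Rlt_le, (well_pos _ _ _ _ _ HF), Hr.
Qed.

(** The potential being [C^2], differentiating Newton's equation provides the
    third derivative that a classical solution needs. *)
Lemma profile_korteweg (Psi F F1 : R -> R) (m g l e c d : R) (u u1 u2 : R -> R) :
  C2_pos Psi ->
  C2_double_well F F1 (fun r => Derive_n Psi 2 r - m ^ 2 / r ^ 3) g l ->
  0 < e -> (forall x, 0 < u x) ->
  profile_equations F F1 e c d u u1 u2 ->
  korteweg_solution Psi m e u.
Proof.
  intros HPsi HF He Hpos [D1 [D2 [E1 _]]].
  set (u3 := fun x => u1 x * (Derive_n Psi 2 (u x) - m ^ 2 / u x ^ 3) / e).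
  assert (D3 : forall x, is_derive u2 x (u3 x)).
  { intros x. apply is_derive_ext with (fun y => / e * (F1 (u y) + c)).
    - intros y. rewrite <- E1. change (/ e * (e * u2 y) = u2 y). field. lra.
    - replace (u3 x) with
        (/ e * (plus (u1 x * (Derive_n Psi 2 (u x) - m ^ 2 / u x ^ 3)) 0))
        by (unfold u3, plus; simpl; field; split; [apply Rgt_not_eq, Hpos | lra]).
      apply (is_derive_scal (fun y => F1 (u y) + c)).
      apply (is_derive_plus (fun y => F1 (u y)) (fun _ => c)).
      + apply (is_derive_comp F1 u); [|apply D1].
        apply (well_derive2 _ _ _ _ _ HF), Hpos.
      + apply @is_derive_const. }
  assert (N1 : Derive u = u1).
  { apply functional_extensionality. intros x. apply is_derive_unique, D1. }
  assert (N2 : Derive_n u 2 = u2).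
  { change (Derive_n u 2) with (Derive (Derive u)). rewrite N1.
    apply functional_extensionality. intros x. apply is_derive_unique, D2. }
  split; [exact Hpos|]. split.
  - intros k x Hk. destruct k as [|[|[|[|k]]]]; [exact I| | | |lia].
    + exists (u1 x). apply D1.
    + change (ex_derive (Derive u) x). rewrite N1. exists (u2 x). apply D2.
    + change (ex_derive (Derive_n u 2) x). rewrite N2. exists (u3 x). apply D3.
  - intros x. apply (korteweg_equation_iff Psi u m e (u1 x) (u3 x) x HPsi (Hpos x) (D1 x)).
    + rewrite N2. apply D3.
    + unfold u3. field. split; [apply Rgt_not_eq, Hpos | lra].
Qed.

(** * Uniqueness of the traveling wave *)

(** The force [F1] is Lipschitz on compact sets of positive densities, so no
    bound on the range of [u] and [w] is needed. *)
Lemma profile_unique (F F1 F2 : R -> R) (g l e c d d' : R) (u u1 u2 w w1 w2 : R -> R) :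
  C2_double_well F F1 F2 g l -> 0 < e ->
  profile_equations F F1 e c d u u1 u2 -> profile_equations F F1 e c d' w w1 w2 ->
  (forall x, 0 < u x) -> (forall x, 0 < w x) ->
  u 0 = w 0 -> u1 0 = w1 0 -> forall x, u x = w x.
Proof.
  intros HF He [U1 [U2 [U3 _]]] [V1 [V2 [V3 _]]] Hu Hw H0 H1 x.
  set (A := Rabs x). assert (HA : 0 <= A) by apply Rabs_pos.
  assert (Hrange : forall f df : R -> R, (forall x, is_derive f x (df x)) ->
    (forall x, 0 < f x) ->
    exists p q, 0 < p /\ forall y, Rabs y <= A -> p <= f y <= q).
  { intros f df Hd Hpos.
    assert (Hc : forall y, - A <= y <= A -> continuity_pt f y).
    { intros y _. apply continuity_pt_filterlim.
      apply (ex_derive_continuous f). eexists; apply Hd. }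
    destruct (continuity_ab_min f (- A) A ltac:(lra) Hc) as [a [Ha _]].
    destruct (continuity_ab_maj f (- A) A ltac:(lra) Hc) as [b [Hb _]].
    exists (f a), (f b). split; [apply Hpos|]. intros y Hy.
    apply Rabs_le_between in Hy. split; auto. }
  destruct (Hrange u u1 U1 Hu) as [p [q [Hp Hpq]]].
  destruct (Hrange w w1 V1 Hw) as [p' [q' [Hp' Hpq']]].
  assert (A0 : Rabs 0 <= A) by (rewrite Rabs_R0; exact HA).
  pose proof (Hpq 0 A0). pose proof (Hpq' 0 A0).
  pose proof (Rmin_l p p'). pose proof (Rmin_r p p').
  pose proof (Rmax_l q q'). pose proof (Rmax_r q q').
  assert (0 < Rmin p p') by (apply Rmin_glb_lt; lra).
  destruct (double_well_lipschitz _ _ _ _ _ (Rmin p p') (Rmax q q') HF ltac:(lra))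
    as [L [HL Hlip]].
  assert (S : (u x - w x) ^ 2 <=
    ((u 0 - w 0) ^ 2 + (u1 0 - w1 0) ^ 2 + 0 ^ 2) * exp ((2 + L / e) * A)).
  { apply second_order_stability with u2 w2; auto; try lra.
    - apply Rlt_le, Rdiv_lt_0_compat; lra.
    - intros y Hy. pose proof (Hpq y Hy). pose proof (Hpq' y Hy).
      replace (u2 y - w2 y) with (/ e * (F1 (u y) - F1 (w y))).
      + assert (0 < / e) by (apply Rinv_0_lt_compat; lra).
        rewrite Rabs_mult, (Rabs_pos_eq (/ e)) by lra.
        replace (L / e * Rabs (u y - w y) + 0)
          with (/ e * (L * Rabs (u y - w y))) by (field; lra).
        apply Rmult_le_compat_l; [lra|]. apply Hlip; lra.
      + replace (F1 (u y) - F1 (w y)) with (e * (u2 y - w2 y))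
          by (rewrite Rmult_minus_distr_l, U3, V3; ring).
        field. lra.
    - apply Rle_refl. }
  rewrite H0, H1 in S.
  replace ((w 0 - w 0) ^ 2 + (w1 0 - w1 0) ^ 2 + 0 ^ 2) with 0 in S by ring.
  rewrite Rmult_0_l in S. pose proof (pow2_ge_0 (u x - w x)).
  assert (E : (u x - w x) ^ 2 = 0) by lra.
  simpl in E. rewrite Rmult_1_r in E. apply Rmult_integral in E. lra.
Qed.

(** If [r] has a limit at infinity, its slope is small at arbitrarily late times,
    so the conserved energy forces [G] to vanish at the limit. *)
Lemma energy_vanishes_at_limit (r r1 G : R -> R) (k L : R) :
  (forall x, is_derive r x (r1 x)) -> continuous G L ->
  (forall x, k * r1 x ^ 2 = G (r x)) ->
  is_lim r p_infty L -> G L = 0.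
Proof.
  intros Hd HG HE Hlim. apply NNPP. intros Hne.
  set (t := Rabs (G L)).
  assert (Ht : 0 < t) by (apply Rabs_pos_lt, Hne).
  destruct (continuous_epsilon_delta G L (t / 2) HG ltac:(lra)) as [d [Hd0 Hdl]].
  pose proof (Rabs_pos k) as Hk.
  (* once [r] is within [s] of [L], some slope is at most [2 * s]; the choice of
     [s] makes [Rabs k * (2 * s) ^ 2] at most [t / 2] *)
  set (s := Rmin (Rmin d (1 / 2)) (t / (4 * (Rabs k + 1)))).
  assert (Hs : 0 < s).
  { repeat apply Rmin_glb_lt; try lra. apply Rdiv_lt_0_compat; lra. }
  assert (Hs1 : s <= d) by (eapply Rle_trans; [apply Rmin_l | apply Rmin_l]).
  assert (Hs2 : s <= 1 / 2) by (eapply Rle_trans; [apply Rmin_l | apply Rmin_r]).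
  assert (Hs3 : s * (4 * (Rabs k + 1)) <= t).
  { apply Rle_trans with (t / (4 * (Rabs k + 1)) * (4 * (Rabs k + 1))).
    - apply Rmult_le_compat_r; [lra | apply Rmin_r].
    - right. field. lra. }
  apply is_lim_spec in Hlim. destruct (Hlim (mkposreal s Hs)) as [M HM].
  simpl in HM.
  destruct (mvt_is_derive r r1 (M + 1) (M + 2)) as [x [Hx E]]; [auto|].
  rewrite Rmin_left, Rmax_right in Hx by lra.
  pose proof (HM (M + 1) ltac:(lra)) as B1. pose proof (HM (M + 2) ltac:(lra)) as B2.
  pose proof (HM x ltac:(lra)) as B3.
  specialize (Hdl (r x) ltac:(lra)). rewrite <- HE in Hdl.
  assert (Hr1 : Rabs (r1 x) <= 2 * s).
  { replace (r1 x) with (r (M + 2) - r (M + 1)) by (rewrite E; ring).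
    apply Rabs_def2 in B1, B2. apply Rabs_le. lra. }
  assert (Hsq : Rabs (k * r1 x ^ 2) <= t / 2).
  { rewrite Rabs_mult, <- RPow_abs.
    pose proof (Rabs_pos (r1 x)).
    assert (Rabs (r1 x) ^ 2 <= 2 * s) by nra.
    assert (Rabs k * Rabs (r1 x) ^ 2 <= Rabs k * (2 * s))
      by (apply Rmult_le_compat_l; lra).
    nra. }
  assert (t <= Rabs (k * r1 x ^ 2) + Rabs (k * r1 x ^ 2 - G L)).
  { unfold t. replace (G L) with (k * r1 x ^ 2 - (k * r1 x ^ 2 - G L)) at 1 by ring.
    unfold Rminus at 1. rewrite <- (Rabs_Ropp (k * r1 x ^ 2 - G L)).
    apply Rabs_triang. }
  lra.
Qed.

(** The limits at both ends force both integration constants to vanish.  The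
    wave then crosses the midpoint density upwards with the same slope as
    [rho]. *)
Lemma traveling_wave_is_translate
  (Psi F F1 : R -> R) (m g l e : R) (rho r : R -> R) :
  C2_pos Psi ->
  C2_double_well F F1 (fun r => Derive_n Psi 2 r - m ^ 2 / r ^ 3) g l -> 0 < e ->
  rho 0 = (g + l) / 2 -> (forall x, g < rho x < l) ->
  (forall x, is_derive rho x (well_speed F e (rho x))) ->
  traveling_wave Psi m e g l r ->
  exists a, forall x, r x = rho (x + a).
Proof.
  intros HPsi HF He Hmid Hr Hd [Hk [Hm Hp]].
  pose proof (well_order _ _ _ _ _ HF) as Hgl.
  destruct (korteweg_first_integrals _ _ _ _ _ _ _ _ HPsi HF Hk)
    as [c [d [D1 [D2 [E1 E2]]]]].
  destruct Hk as [Hpos _].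
  assert (HG : forall z, 0 < z -> continuous (fun z => F z + c * z + d) z).
  { intros z Hz. apply (ex_derive_continuous (fun z => F z + c * z + d)).
    auto_derive. exists (F1 z). now apply (well_derive1 _ _ _ _ _ HF). }
  assert (El : F l + c * l + d = 0).
  { apply (energy_vanishes_at_limit r (Derive r) (fun z => F z + c * z + d) (e / 2) l);
      auto. apply HG; lra. }
  (* the limit at [m_infty] is reached by reflection, which preserves the energy *)
  assert (Eg : F g + c * g + d = 0).
  { apply (energy_vanishes_at_limit (fun x => r (- x)) (fun x => - Derive r (- x))
      (fun z => F z + c * z + d) (e / 2) g).
    - intros x. pose proof (D1 (- x)) as Dx. auto_derive.
      + exists (Derive r (- x)); exact Dx.
      + change (Derive (fun x0 : R => r x0) (- x)) with (Derive r (- x)). ring.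
    - apply HG; lra.
    - intros x. rewrite <- E2. ring.
    - apply is_lim_spec. apply is_lim_spec in Hm. intros s.
      destruct (Hm s) as [M HM]. exists (- M). intros x Hx. apply HM. lra. }
  rewrite (well_zero_l _ _ _ _ _ HF) in El. rewrite (well_zero_g _ _ _ _ _ HF) in Eg.
  assert (Hc : c = 0).
  { assert (P : c * (l - g) = 0) by lra. apply Rmult_integral in P. lra. }
  assert (Hd0 : d = 0) by (rewrite Hc in Eg; lra).
  subst c d.
  assert (Hsmall : 0 < (l - g) / 2) by lra.
  apply is_lim_spec in Hm. apply is_lim_spec in Hp.
  destruct (Hm (mkposreal _ Hsmall)) as [M1 HM1].
  destruct (Hp (mkposreal _ Hsmall)) as [M2 HM2]. simpl in HM1, HM2.
  set (x1 := Rmin M1 M2 - 1). set (x2 := Rmax M1 M2 + 1).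
  pose proof (Rmin_l M1 M2). pose proof (Rmax_l M1 M2). pose proof (Rmax_r M1 M2).
  specialize (HM1 x1 ltac:(unfold x1; lra)). specialize (HM2 x2 ltac:(unfold x2; lra)).
  apply Rabs_def2 in HM1. apply Rabs_def2 in HM2.
  destruct (last_upcrossing r (Derive r) x1 x2 ((g + l) / 2))
    as [s [Hs Hs']]; [unfold x1, x2; lra | exact D1 | lra |].
  exists (- s). intros x.
  assert (Key : forall y, r (y + s) = rho y).
  { destruct (heteroclinic_profile _ _ _ _ _ e rho HF He Hr Hd) as [P1 [P2 [P3 P4]]].
    apply (profile_unique F F1 (fun r => Derive_n Psi 2 r - m ^ 2 / r ^ 3) g l e 0 0 0
      (fun y => r (y + s)) (fun y => Derive r (y + s)) (fun y => Derive_n r 2 (y + s))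
      rho (fun x => well_speed F e (rho x)) (fun x => F1 (rho x) / e)); auto.
    - split; [|split; [|split]].
      + intros y. pose proof (D1 (y + s)) as Dy. auto_derive.
        * exists (Derive r (y + s)); exact Dy.
        * change (Derive (fun x0 : R => r x0) (y + s)) with (Derive r (y + s)). ring.
      + intros y. pose proof (D2 (y + s)) as Dy. auto_derive.
        * exists (Derive_n r 2 (y + s)); exact Dy.
        * change (Derive (fun x0 : R => Derive r x0) (y + s))
            with (Derive_n r 2 (y + s)). ring.
      + intros y. apply E1.
      + intros y. apply E2.
    - exact (conj P1 (conj P2 (conj P3 P4))).
    - intros y. pose proof (Hr y). lra.
    - rewrite Rplus_0_l, Hmid. exact Hs.
    - rewrite Rplus_0_l, Hmid. unfold well_speed.
      rewrite <- (sqrt_pow2 (Derive r s)) by exact Hs'. f_equal.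
      specialize (E2 s). rewrite Hs in E2.
      replace (F ((g + l) / 2)) with (e / 2 * Derive r s ^ 2) by lra.
      field. lra. }
  rewrite <- Key. f_equal. ring.
Qed.

(** * Convergence of the rescaled periodic solutions *)

(** The line [- c * r - d] meets the graph of [F] at points close to the wells,
    where [F] vanishes; two such points determine [c] and [d]. *)
Lemma integration_constants_small (F F1 F2 : R -> R) (g l eta : R) :
  C2_double_well F F1 F2 g l -> 0 < eta ->
  exists th, 0 < th /\ forall a b c d,
    g <= a < g + th -> l - th < b <= l ->
    F a + c * a + d = 0 -> F b + c * b + d = 0 ->
    Rabs c < eta /\ Rabs d < eta.
Proof.
  intros HF Heta. pose proof (well_order _ _ _ _ _ HF) as Hgl.
  assert (HC : forall z, 0 < z -> continuous F z).
  { intros z Hz. apply (ex_derive_continuous F). exists (F1 z).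
    now apply (well_derive1 _ _ _ _ _ HF). }
  (* [b - a >= (l - g) / 2], so a bound [k] on [F a] and [F b] gives
     [Rabs c <= 4 * k / (l - g)] and [Rabs d <= k + Rabs c * l]; hence [M] *)
  set (M := 1 + 4 * (1 + l) / (l - g)).
  assert (HM : M * (l - g) = (l - g) + 4 * (1 + l)) by (unfold M; field; lra).
  assert (HM1 : 0 < M).
  { unfold M. assert (0 < 4 * (1 + l) / (l - g)) by (apply Rdiv_lt_0_compat; lra). lra. }
  set (k := eta / (2 * M)).
  assert (Hk : 0 < k) by (apply Rdiv_lt_0_compat; lra).
  assert (HkM : k * M = eta / 2) by (unfold k; field; lra).
  destruct (continuous_epsilon_delta F g k (HC g ltac:(lra)) Hk) as [d1 [Hd1 Hd1']].
  destruct (continuous_epsilon_delta F l k (HC l ltac:(lra)) Hk) as [d2 [Hd2 Hd2']].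
  exists (Rmin (Rmin d1 d2) ((l - g) / 4)).
  pose proof (Rmin_l (Rmin d1 d2) ((l - g) / 4)).
  pose proof (Rmin_r (Rmin d1 d2) ((l - g) / 4)).
  pose proof (Rmin_l d1 d2). pose proof (Rmin_r d1 d2).
  split; [repeat apply Rmin_glb_lt; lra|].
  intros a b c d Ha Hb Ea Eb.
  specialize (Hd1' a ltac:(apply Rabs_def1; lra)).
  specialize (Hd2' b ltac:(apply Rabs_def1; lra)).
  rewrite (well_zero_g _ _ _ _ _ HF) in Hd1'. rewrite (well_zero_l _ _ _ _ _ HF) in Hd2'.
  apply Rabs_def2 in Hd1'. apply Rabs_def2 in Hd2'.
  assert (Hcba : Rabs c * (b - a) < 2 * k).
  { rewrite <- (Rabs_pos_eq (b - a)) by lra. rewrite <- Rabs_mult.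
    apply Rabs_def1; lra. }
  pose proof (Rabs_pos c) as Hc0.
  assert (Hc : Rabs c * (l - g) <= 4 * k) by nra.
  assert (HkM' : k * (M * (l - g)) = eta / 2 * (l - g)) by (rewrite <- Rmult_assoc, HkM; ring).
  rewrite HM in HkM'.
  assert (Hce : Rabs c * (l - g) < eta * (l - g)) by nra.
  assert (Hdd : Rabs d <= k + Rabs c * l).
  { replace d with (- F a - c * a) by lra. unfold Rminus.
    eapply Rle_trans; [apply Rabs_triang|]. rewrite !Rabs_Ropp, Rabs_mult.
    rewrite (Rabs_pos_eq a) by lra. apply Rplus_le_compat.
    - apply Rabs_le. lra.
    - apply Rmult_le_compat_l; lra. }
  assert (Hde : Rabs d * (l - g) < eta * (l - g)).
  { assert (Rabs d * (l - g) <= (k + Rabs c * l) * (l - g))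
      by (apply Rmult_le_compat_r; lra).
    assert (Rabs c * (l - g) * l <= 4 * k * l) by (apply Rmult_le_compat_r; lra).
    nra. }
  split; apply Rmult_lt_reg_r with (l - g); lra.
Qed.

(** The slope vanishes at the minimum and the maximum of the periodic solution,
    and the convergence in mean pushes these extreme values to the wells. *)
Lemma periodic_profiles_near_well
  (Psi F F1 : R -> R) (m g l eps0 eta : R) (rho : R -> R -> R) :
  C2_pos Psi ->
  C2_double_well F F1 (fun r => Derive_n Psi 2 r - m ^ 2 / r ^ 3) g l ->
  0 < eps0 ->
  (forall e, 0 < e < eps0 ->
     korteweg_solution Psi m e (rho e) /\ periodic1 (rho e) /\
     (forall x, g <= rho e x <= l)) ->
  two_phase_limit g l rho -> 0 < eta ->
  exists e1, 0 < e1 <= eps0 /\ forall e, 0 < e < e1 ->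
    exists c d s, Rabs c < eta /\ Rabs d < eta /\
      profile_equations F F1 e c d (rho e) (Derive (rho e)) (Derive_n (rho e) 2) /\
      rho e s = (g + l) / 2 /\ 0 <= Derive (rho e) s.
Proof.
  intros HPsi HF He0 Hsol Hlim Heta. pose proof (well_order _ _ _ _ _ HF) as Hgl.
  destruct (integration_constants_small _ _ _ _ _ eta HF Heta) as [th [Hth Hsmall]].
  assert (Hcont : forall e, 0 < e < eps0 -> forall x, continuous (rho e) x).
  { intros e He x. destruct (Hsol e He) as [[_ [Hex _]] _].
    apply (ex_derive_continuous (rho e)). exact (Hex 1%nat x ltac:(lia)). }
  assert (Hth' : 0 < Rmin th ((l - g) / 2)) by (apply Rmin_glb_lt; lra).
  pose proof (Rmin_l th ((l - g) / 2)). pose proof (Rmin_r th ((l - g) / 2)).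
  destruct (two_phase_limit_values g l eps0 rho He0 Hcont Hlim _ Hth') as [e1 [He1 Hnear]].
  exists (Rmin e1 eps0).
  pose proof (Rmin_l e1 eps0). pose proof (Rmin_r e1 eps0).
  split; [split; [apply Rmin_glb_lt; lra | lra]|]. intros e He.
  destruct (Hsol e ltac:(lra)) as [Hk [Hper Hran]].
  destruct (korteweg_first_integrals _ _ _ _ _ _ _ _ HPsi HF Hk)
    as [c [d Hprof]].
  pose proof Hprof as [D1 [D2 [E1 E2]]].
  destruct (periodic1_extrema (rho e) (Derive (rho e)) Hper D1)
    as [xa [xb [Hab [Hmm [Ha Hb]]]]].
  destruct (Hnear e ltac:(lra)) as [[y1 Hy1] [y2 Hy2]].
  apply Rabs_def2 in Hy1. apply Rabs_def2 in Hy2.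
  pose proof (Hran xa). pose proof (Hran xb).
  pose proof (Hmm y1). pose proof (Hmm y2).
  pose proof (E2 xa) as Ea. pose proof (E2 xb) as Eb. rewrite Ha in Ea. rewrite Hb in Eb.
  destruct (Hsmall (rho e xa) (rho e xb) c d) as [Hc Hd]; try lra.
  destruct (last_upcrossing (rho e) (Derive (rho e)) xa xb ((g + l) / 2) Hab D1)
    as [s [Hs Hs']]; [lra|].
  exists c, d, s. auto.
Qed.

(** Stretching changes the capillarity coefficient but neither integration
    constant. *)
Lemma profile_rescale (F F1 u u1 u2 : R -> R) (eps w c d s : R) :
  0 < w -> profile_equations F F1 (eps / w ^ 2) c d u u1 u2 ->
  profile_equations F F1 eps c d (fun x => u ((x + s) / w))
    (fun x => u1 ((x + s) / w) / w) (fun x => u2 ((x + s) / w) / w ^ 2).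
Proof.
  intros Hw [D1 [D2 [E1 E2]]]. split; [|split; [|split]].
  - intros x. pose proof (D1 ((x + s) / w)) as Dx. auto_derive.
    + exists (u1 ((x + s) / w)); exact Dx.
    + change (Derive (fun x0 : R => u x0)) with (Derive u).
      change ((x + s) * / w) with ((x + s) / w).
      rewrite (is_derive_unique u _ _ Dx). field. lra.
  - intros x. pose proof (D2 ((x + s) / w)) as Dx. auto_derive.
    + exists (u2 ((x + s) / w)); exact Dx.
    + change (Derive (fun x0 : R => u1 x0)) with (Derive u1).
      change ((x + s) * / w) with ((x + s) / w).
      rewrite (is_derive_unique u1 _ _ Dx). field. lra.
  - intros x. rewrite <- E1. field. lra.
  - intros x. rewrite <- E2. field. lra.
Qed.

(** A profile with small integration constants that passes upwards through the
    midpoint at the origin stays uniformly close to [rho] up to distance [A]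
    from the origin. *)
Lemma profile_close (F F1 F2 : R -> R) (g l e A err : R) (rho : R -> R) :
  C2_double_well F F1 F2 g l -> 0 < e -> 0 < err ->
  rho 0 = (g + l) / 2 -> (forall x, g < rho x < l) ->
  (forall x, is_derive rho x (well_speed F e (rho x))) ->
  exists eta, 0 < eta /\ forall c d u u1 u2,
    Rabs c < eta -> Rabs d < eta ->
    profile_equations F F1 e c d u u1 u2 ->
    (forall x, g <= u x <= l) -> u 0 = (g + l) / 2 -> 0 <= u1 0 ->
    forall x, Rabs x <= A -> Rabs (u x - rho x) < err.
Proof.
  intros HF He Herr Hmid Hr Hd. pose proof (well_order _ _ _ _ _ HF) as Hgl.
  destruct (heteroclinic_profile _ _ _ _ _ e rho HF He Hr Hd) as [P1 [P2 [P3 P4]]].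
  destruct (double_well_lipschitz _ _ _ _ _ g l HF ltac:(lra)) as [L [HL Hlip]].
  set (p0 := well_speed F e (rho 0)).
  assert (Hp0 : 0 < p0) by apply (well_speed_pos _ _ _ _ _ e _ HF He (Hr 0)).
  (* the slopes at the origin differ by at most [B * eta], so the squared
     distance up to [A] from the origin is at most [Q * eta ^ 2] *)
  set (B := 2 / e * (rho 0 + 1) / p0).
  set (X := exp ((2 + L / e) * A)).
  set (Q := (B ^ 2 + (/ e) ^ 2) * X).
  assert (HX : 0 < X) by apply exp_pos.
  assert (HQ : 0 <= Q).
  { apply Rmult_le_pos; [|lra]. pose proof (pow2_ge_0 B). pose proof (pow2_ge_0 (/ e)). lra. }
  assert (He' : 0 < / e) by (apply Rinv_0_lt_compat; lra).
  set (eta := Rmin 1 (err ^ 2 / (Q + 1))).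
  assert (Herr2 : 0 < err ^ 2) by (apply pow_lt; lra).
  assert (Heta : 0 < eta).
  { apply Rmin_glb_lt; [lra | apply Rdiv_lt_0_compat; lra]. }
  assert (Heta1 : eta <= 1) by apply Rmin_l.
  assert (Heta2 : eta * (Q + 1) <= err ^ 2).
  { apply Rle_trans with (err ^ 2 / (Q + 1) * (Q + 1)).
    - apply Rmult_le_compat_r; [lra | apply Rmin_r].
    - right. field. lra. }
  exists eta. split; [exact Heta|].
  intros c d u u1 u2 Hc Hdd [U1 [U2 [U3 U4]]] Hu Hu0 Hu1 x Hx.
  (* difference of the two energy identities at the common value [rho 0] *)
  assert (Hslope : Rabs (u1 0 - p0) <= B * eta).
  { specialize (U4 0). specialize (P4 0). cbv beta in P4. fold p0 in P4.
    rewrite Hu0, <- Hmid in U4.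
    assert (E : (u1 0 - p0) * (u1 0 + p0) = 2 / e * (c * rho 0 + d)).
    { replace (c * rho 0 + d) with (e / 2 * u1 0 ^ 2 - e / 2 * p0 ^ 2) by lra.
      field. lra. }
    assert (Habs : Rabs (u1 0 - p0) * (u1 0 + p0) <= 2 / e * ((rho 0 + 1) * eta)).
    { rewrite <- (Rabs_pos_eq (u1 0 + p0)) by lra. rewrite <- Rabs_mult, E, Rabs_mult.
      assert (0 < 2 / e) by (apply Rdiv_lt_0_compat; lra).
      rewrite (Rabs_pos_eq (2 / e)) by lra. apply Rmult_le_compat_l; [lra|].
      eapply Rle_trans; [apply Rabs_triang|]. rewrite Rabs_mult.
      pose proof (Hr 0). rewrite (Rabs_pos_eq (rho 0)) by lra. nra. }
    apply Rmult_le_reg_r with p0; [exact Hp0|].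
    replace (B * eta * p0) with (2 / e * ((rho 0 + 1) * eta)) by (unfold B; field; lra).
    pose proof (Rabs_pos (u1 0 - p0)). nra. }
  assert (S : (u x - rho x) ^ 2 <=
    ((u 0 - rho 0) ^ 2 + (u1 0 - p0) ^ 2 + (Rabs c / e) ^ 2) * X).
  { apply (second_order_stability u u1 u2 rho (fun x => well_speed F e (rho x))
      (fun x => F1 (rho x) / e) (L / e) (Rabs c / e) A); auto.
    - apply Rlt_le, Rdiv_lt_0_compat; lra.
    - apply Rmult_le_pos; [apply Rabs_pos | lra].
    - intros y _. pose proof (Hr y).
      replace (u2 y - F1 (rho y) / e) with (/ e * ((F1 (u y) - F1 (rho y)) + c)).
      + rewrite Rabs_mult, (Rabs_pos_eq (/ e)) by lra.
        replace (L / e * Rabs (u y - rho y) + Rabs c / e)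
          with (/ e * (L * Rabs (u y - rho y) + Rabs c)) by (field; lra).
        apply Rmult_le_compat_l; [lra|].
        eapply Rle_trans; [apply Rabs_triang|]. apply Rplus_le_compat_r.
        apply Hlip; [apply Hu | lra].
      + replace (F1 (u y) - F1 (rho y) + c) with (e * u2 y - F1 (rho y))
          by (rewrite U3; ring). field. lra. }
  assert (Hslope2 : (u1 0 - p0) ^ 2 <= (B * eta) ^ 2).
  { rewrite <- (pow2_abs (u1 0 - p0)). apply pow_incr. split; [apply Rabs_pos | exact Hslope]. }
  assert (Hc2 : (Rabs c / e) ^ 2 <= (/ e * eta) ^ 2).
  { apply pow_incr. pose proof (Rabs_pos c). split.
    - apply Rmult_le_pos; lra.
    - unfold Rdiv. rewrite Rmult_comm. apply Rmult_le_compat_l; lra. }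
  assert (Hfin : (u x - rho x) ^ 2 < err ^ 2).
  { eapply Rle_lt_trans; [exact S|].
    replace (u 0 - rho 0) with 0 by (rewrite Hu0, Hmid; ring).
    apply Rle_lt_trans with (((B * eta) ^ 2 + (/ e * eta) ^ 2) * X).
    - apply Rmult_le_compat_r; lra.
    - replace (((B * eta) ^ 2 + (/ e * eta) ^ 2) * X) with (eta * (eta * Q))
        by (unfold Q; ring).
      assert (0 <= eta * Q) by (apply Rmult_le_pos; lra). nra. }
  rewrite <- (pow2_abs (u x - rho x)) in Hfin.
  apply Rnot_le_lt. intros h. pose proof (pow_incr err _ 2 (conj (Rlt_le _ _ Herr) h)). lra.
Qed.

Theorem theorem4p4
  (Psi : R -> R) (rho_g rho_l m rho_gm rho_lm rho_star w_star eps0 eps : R)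
  (rho1 : R -> R -> R)
  (HPsi : C2_pos Psi)
  (Hbit : bitangent Psi rho_g rho_l)
  (Hbitm : bitangent (Psi_m Psi m) rho_gm rho_lm)
  (Hstar : rho_gm < rho_star < rho_lm)
  (Hw : -1 < w_star < 1)
  (Hcrit : forall w, -1 < w < 1 ->
     (Derive (W (Psi_m Psi m) rho_gm rho_lm) w = 0 <-> w = w_star))
  (Hnondeg : Derive_n (W (Psi_m Psi m) rho_gm rho_lm) 2 w_star < 0)
  (Heps0 : 0 < eps0)
  (Hrho1 : forall e, 0 < e < eps0 ->
     korteweg_solution Psi m e (rho1 e) /\
     periodic1 (rho1 e) /\
     (exists x y, rho1 e x <> rho1 e y) /\
     RInt (rho1 e) 0 1 = rho_star /\
     (forall x, rho_gm <= rho1 e x <= rho_lm))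
  (Hlim : two_phase_limit rho_gm rho_lm rho1)
  (Heps : 0 < eps) :
  exists rho_inf : R -> R,
    traveling_wave Psi m eps rho_gm rho_lm rho_inf /\
    (forall r, traveling_wave Psi m eps rho_gm rho_lm r ->
       exists a, forall x, r x = rho_inf (x + a)) /\
    (forall x y, x <= y -> rho_inf x <= rho_inf y) /\
    exists delta : R -> R,
      cvg_loc_unif
        (fun omega x => rho1 (eps / omega ^ 2) ((x + delta omega) / omega))
        rho_inf.
Proof.
  pose proof (bitangent_double_well Psi m rho_gm rho_lm HPsi Hbitm) as HF.
  pose proof (well_order _ _ _ _ _ HF) as Hgl.
  destruct (heteroclinic_exists _ _ _ _ _ eps HF Heps)
    as [rho [Hmid [Hr [Hmono [Hd [Hm Hp]]]]]].
  exists rho. split; [|split; [|split]].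
  - split; [|split; assumption].
    eapply profile_korteweg; [exact HPsi | exact HF | exact Heps | |].
    + intros x. pose proof (Hr x). lra.
    + exact (heteroclinic_profile _ _ _ _ _ eps rho HF Heps Hr Hd).
  - intros r Htw.
    exact (traveling_wave_is_translate _ _ _ _ _ _ _ _ _ HPsi HF Heps Hmid Hr Hd Htw).
  - intros x y [h|h]; [left; now apply Hmono | right; now rewrite h].
  (* [delta omega] moves an upward crossing of the midpoint density to the
     origin; such a crossing exists once [omega] is large *)
  - set (P := fun omega s => rho1 (eps / omega ^ 2) s = (rho_gm + rho_lm) / 2 /\
                             0 <= Derive (rho1 (eps / omega ^ 2)) s).
    destruct (functional_choice (fun omega s => (exists s', P omega s') -> P omega s)) as [s Hs].
    { intros omega. destruct (classic (exists s', P omega s')) as [[s' H]|H].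
      - now exists s'.
      - exists 0. intros H'. contradiction. }
    exists (fun omega => omega * s omega).
    intros A err Herr.
    destruct (profile_close _ _ _ _ _ eps A err rho HF Heps Herr Hmid Hr Hd)
      as [eta [Heta Hclose]].
    destruct (periodic_profiles_near_well _ _ _ m rho_gm rho_lm eps0 eta rho1
      HPsi HF Heps0) as [e1 [He1 Hnear]]; auto.
    { intros e He. destruct (Hrho1 e He) as [H1 [H2 [_ [_ H3]]]]. auto. }
    exists (Rmax 1 (eps / e1)). intros omega Homega x Hx.
    pose proof (Rmax_l 1 (eps / e1)). pose proof (Rmax_r 1 (eps / e1)).
    assert (Hw2 : 0 < omega ^ 2) by (apply pow_lt; lra).
    assert (He : 0 < eps / omega ^ 2 < e1).
    { split; [apply Rdiv_lt_0_compat; lra|].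
      assert (Hlt : eps / e1 < omega ^ 2) by nra.
      apply Rmult_lt_reg_r with (omega ^ 2); [exact Hw2|].
      replace (eps / omega ^ 2 * omega ^ 2) with eps by (field; lra).
      replace eps with (e1 * (eps / e1)) by (field; lra).
      apply Rmult_lt_compat_l; lra. }
    destruct (Hnear _ He) as [c [d [s' [Hc [Hdd [Hprof Hs']]]]]].
    destruct (Hs omega (ex_intro _ s' Hs')) as [Hs1 Hs2].
    destruct (Hrho1 _ (conj (proj1 He) (Rlt_le_trans _ _ _ (proj2 He) (proj2 He1))))
      as [_ [_ [_ [_ Hran]]]].
    assert (Hzero : (0 + omega * s omega) / omega = s omega) by (field; lra).
    apply (Hclose c d _ _ _ Hc Hdd
      (profile_rescale _ _ _ _ _ eps omega c d (omega * s omega) ltac:(lra) Hprof)).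
    + intros y. apply Hran.
    + rewrite Hzero. exact Hs1.
    + rewrite Hzero. apply Rmult_le_pos; [exact Hs2|].
      apply Rlt_le, Rinv_0_lt_compat. lra.
    + exact Hx.
Qed.
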